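(* For all integers $r\ge 4$ and $t$ with $2\le t\le r-1$, the limit $\lim_{n\to\infty} n^{-t} f^{(r)}(n;4r-3t,4)$ exists and $$\lim_{n\to\infty} n^{-t} f^{(r)}(n;4r-3t,4)=\frac{1}{t!}\binom{r}{t}^{-1}.$$
   Context: An $r$-graph is a finite $r$-uniform hypergraph (its edge set is a set of $r$-element subsets of its finite vertex set). For positive integers $r,s,k,n$, $f^{(r)}(n;s,k)$ denotes the maximum number of edges in an $r$-graph on $n$ vertices that contains no subgraph with exactly $k$ edges and at most $s$ vertices; equivalently, in which there are no $k$ distinct edges whose union has at most $s$ vertices. *)

(* Defs.v *)
From mathcomp Require Import all_boot.

Set Implicit Arguments.
Unset Strict Implicit.
Unset Printing Implicit Defensive.

(* An r-graph on the vertex set V is identified with its edge set. *)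
Definition is_rgraph (V : finType) (r : nat) (E : {set {set V}}) : bool :=
  [forall e in E, #|e| == r].

Definition has_sparse_subgraph (V : finType) (s k : nat) (E : {set {set V}}) : bool :=
  [exists F : {set {set V}}, [&& F \subset E, #|F| == k & #|cover F| <= s]].

(* The Brown-Erdos-Sos number f^(r)(n; s, k). *)
Definition bes_number (r n s k : nat) : nat :=
  \max_(E : {set {set 'I_n}} | is_rgraph r E && ~~ has_sparse_subgraph s k E) #|E|.

(* Main.v *)
(** Write [d = r - t] and call a family [F] of [r]-sets sparse if it spans at
    most [|F| d + t] vertices, so that the forbidden configurations are the
    sparse families of four edges.

    Upper bound: after deleting [O(n ^ (t - 1))] edges there are no families of
    two or three edges spanning fewer than [|F| d + t] vertices.  Then count
    [t]-sets: an edge claims its own [t]-subsets, and two edges sharing [t]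
    vertices together claim all [t]-subsets of their union.  Since there is no
    sparse family of four edges, claims collide only inside families of at most
    three edges, and a pair claims enough [t]-sets to pay for two edges.

    Lower bound: a weighted nibble.  One keeps a set [U] of chosen edges without
    conflicts (minimal sparse families of two to four edges) and a fractional
    matching [w] on the edges that can still be added.  In a round every edge is
    selected with probability [del * w f]; edges that could now complete a
    conflict die, and the weights of the survivors are rescaled such that in
    expectation [w] only loses a factor [1 - del].  Putting [x = 1] on [U] and
    [x = w] elsewhere, the coordinates of [x] are martingales, and the total
    weight of the conflicts (a multilinear polynomial in [x]) does not grow in
    expectation up to an error controlled by the weight of denser families,
    which is [O(n ^ (t - 1))].  Hence a linear potential, the number of chosen
    edges plus a multiple of the weight of [w] minus multiples of the two
    polynomials, is almost preserved by a suitable outcome of each round; after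
    boundedly many rounds nearly all weight has been turned into edges. *)

From mathcomp Require Import all_boot all_order all_algebra.
From mathcomp Require Import ring lra zify.
Require Import Defs.
Set Implicit Arguments.
Unset Strict Implicit.
Unset Printing Implicit Defensive.
Import Order.TTheory GRing.Theory Num.Theory.

(** * Sparse families and minimal conflicts *)

Section Sparse.
Variables (T : finType) (t d : nat).
Let r := (d + t)%N.
Implicit Types (A F K L : {set {set T}}) (e f g u : {set T}).

(* With [d = r - t], four edges are sparse iff they span at most [4 * r - 3 * t]
   vertices, and two edges are sparse iff they share at least [t] vertices. *)
Definition sparse F := #|cover F| <= #|F| * d + t.
Definition oversparse F := #|cover F| < #|F| * d + t.

Definition uniform F := [forall e in F, #|e| == r].

Definition conflict K := [&& uniform K, 1 < #|K|, #|K| <= 4, sparse K &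
  [forall L in powerset K, (1 < #|L|) && sparse L ==> (L == K)]].

Lemma coverU F L : cover (F :|: L) = cover F :|: cover L.
Proof. by rewrite /cover bigcup_setU. Qed.

Lemma cover_sub F L : F \subset L -> cover F \subset cover L.
Proof.
move=> sFL; apply/bigcupsP => e eF; apply: bigcup_sup; exact: (subsetP sFL).
Qed.

Lemma sub_cover F e : e \in F -> e \subset cover F.
Proof. by move=> eF; apply: (bigcup_sup e). Qed.

Lemma cover_pair e f : cover [set e; f] = e :|: f.
Proof. by rewrite /cover bigcup_setU !big_set1. Qed.

(** Inclusion-exclusion on edges and on vertices together: the excess [#|cover F| - #|F| * d] falls
    by at least [k]. The three joining lemmas below take [k] to be 0 or 1. *)
Lemma card_cover_join F L k :
  #|F :&: L| * d + t + k <= #|cover F :&: cover L| -> sparse L ->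
  #|cover (F :|: L)| + k + #|F| * d <= #|F :|: L| * d + #|cover F|.
Proof.
rewrite /sparse coverU; have := cardsUI F L; have := cardsUI (cover F) (cover L).
move: #|cover F :|: _| #|cover F :&: _| #|F :|: L| #|F :&: L| => x y a b e1 e2 h1 h2.
have : (a + b) * d = (#|F| + #|L|) * d by rewrite e2.
rewrite !mulnDl; lia.
Qed.

Lemma sparse_join F L : #|F :&: L| * d + t <= #|cover F :&: cover L| ->
  sparse F -> sparse L -> sparse (F :|: L).
Proof.
move=> h sF sL; have := @card_cover_join F L 0; rewrite addn0 => /(_ h sL).
rewrite /sparse; move: sF; rewrite /sparse; lia.
Qed.

Lemma oversparse_join F L : #|F :&: L| * d + t < #|cover F :&: cover L| ->
  sparse F -> sparse L -> oversparse (F :|: L).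
Proof.
move=> h sF sL; have := @card_cover_join F L 1; rewrite addn1 => /(_ h sL).
move: sF; rewrite /sparse /oversparse; lia.
Qed.

Lemma oversparse_joinl F L : #|F :&: L| * d + t <= #|cover F :&: cover L| ->
  oversparse F -> sparse L -> oversparse (F :|: L).
Proof.
move=> h oF sL; have := @card_cover_join F L 0; rewrite addn0 => /(_ h sL).
move: oF; rewrite /oversparse; lia.
Qed.

Lemma conflictP K : conflict K -> [/\ forall e, e \in K -> #|e| = r,
  1 < #|K|, #|K| <= 4, sparse K &
  forall L, L \subset K -> 1 < #|L| -> sparse L -> L = K].
Proof.
case/and5P=> /forallP uK K2 K4 sK /forallP mK; split=> // [e eK|L LK L2 sL].
  by apply/eqP; have := uK e; rewrite eK.
by apply/eqP; have := mK L; rewrite powersetE LK L2 sL.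
Qed.

(** A single edge spans exactly [d + t] vertices, and a larger proper subfamily is not sparse by
    minimality. The boolean summand records this strictness, which later turns sparse unions into
    oversparse ones. *)
Lemma conflict_proper K L : conflict K -> L \subset K -> L != K -> 0 < #|L| ->
  #|L| * d + t + (1 < #|L|) <= #|cover L|.
Proof.
move=> /conflictP[uK _ _ _ mK] LK neq L0; case: (ltnP 1 #|L|) => L1.
  rewrite addn1 ltnNge; apply: contra neq => sL; apply/eqP; exact: mK.
have /cards1P[e Le] : #|L| == 1 by rewrite eqn_leq L1.
have eK : e \in K by rewrite (subsetP LK) // Le inE.
by rewrite Le /cover big_set1 uK // cards1 mul1n addn0.
Qed.

Lemma cover_setI F L : #|cover (F :&: L)| <= #|cover F :&: cover L|.
Proof.
by apply: subset_leq_card; rewrite subsetI !cover_sub // ?subsetIl ?subsetIr.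
Qed.

Lemma setI_neq_r F L : ~~ (L \subset F) -> F :&: L != L.
Proof. by apply: contra => /eqP <-; apply: subsetIl. Qed.

(** Unless [L] adds nothing, the common edges form a proper subfamily of [L] and already span
    [#|F :&: L| * d + t] vertices, so the join does not raise the excess. *)
Lemma oversparse_grow F L : oversparse F -> conflict L -> 0 < #|F :&: L| ->
  oversparse (F :|: L).
Proof.
move=> oF cL ne; have [sLF|nLF] := boolP (L \subset F).
  by rewrite (setUidPl sLF).
have [_ _ _ sL _] := conflictP cL.
apply: oversparse_joinl => //; apply: leq_trans (cover_setI F L).
by apply: leq_trans (conflict_proper cL (subsetIr _ _) (setI_neq_r nLF) ne); apply: leq_addr.
Qed.

Lemma sparse_grow F L : sparse F -> conflict L -> 0 < #|F :&: L| -> sparse (F :|: L).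
Proof.
move=> oF cL ne; have [sLF|nLF] := boolP (L \subset F).
  by rewrite (setUidPl sLF).
have [_ _ _ sL _] := conflictP cL.
apply: sparse_join => //; apply: leq_trans (cover_setI F L).
by apply: leq_trans (conflict_proper cL (subsetIr _ _) (setI_neq_r nLF) ne); apply: leq_addr.
Qed.

(** Two common edges bring in the strict case of [conflict_proper], and the excess drops by one. *)
Lemma oversparse_proper F L : sparse F -> conflict L -> ~~ (L \subset F) ->
  1 < #|F :&: L| -> oversparse (F :|: L).
Proof.
move=> sF cL nLF ne; have [_ _ _ sL _] := conflictP cL.
apply: oversparse_join => //; apply: leq_trans (cover_setI F L).
have := conflict_proper cL (subsetIr F L) (setI_neq_r nLF) (ltnW ne).
by rewrite ne addn1.
Qed.

Lemma oversparse_pair K L : conflict K -> conflict L -> K != L ->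
  1 < #|K :&: L| -> oversparse (K :|: L).
Proof.
move=> cK cL neq KL; have [_ _ _ sK mK] := conflictP cK.
have [_ L2 _ sL _] := conflictP cL.
apply: oversparse_proper => //; apply: contra neq => LK; apply/eqP/esym.
exact: mK.
Qed.

Lemma sparse_share e f : e != f -> #|e| = r -> #|f| = r ->
  sparse [set e; f] = (t <= #|e :&: f|).
Proof.
move=> ef er fr; rewrite /sparse cover_pair cards2 ef.
have := cardsUI e f; rewrite er fr /r; lia.
Qed.

Lemma conflict_share K e f : conflict K -> e \in K -> f \in K -> e != f ->
  t <= #|e :&: f| -> K = [set e; f].
Proof.
move=> cK eK fK ef tef; have [uK _ _ _ mK] := conflictP cK.
apply/esym/mK; first by rewrite subUset !sub1set eK.
  by rewrite cards2 ef.
by rewrite sparse_share //; apply: uK.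
Qed.

(** A conflict containing both [e] and [f] would be that pair and exclude [g], so [K] and [L]
    differ. With two common edges the union is oversparse; if [g] is the only one, both spans
    contain [g] and [u], hence more than [r] vertices. *)
Lemma bad_join_geom u e f g K L : #|u| = t -> u \subset e -> u \subset f ->
  e != f -> ~~ (u \subset g) -> conflict K -> conflict L ->
  e \in K -> g \in K -> f \in L -> g \in L -> oversparse (K :|: L).
Proof.
move=> ut ue uf ef ug cK cL eK gK fL gL.
have tef : t <= #|e :&: f|.
  by rewrite -ut; apply: subset_leq_card; rewrite subsetI ue.
have eL : e \notin L.
  apply/negP => eL; have := conflict_share cL eL fL ef tef => LE.
  by move: gL ug; rewrite LE !inE => /orP[] /eqP ->; rewrite ?ue ?uf.
have KL : K != L by apply: contraNneq eL => <-.
have [uK _ _ sK _] := conflictP cK; have [_ _ _ sL _] := conflictP cL.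
have [KL2|] := ltnP 1 #|K :&: L|; first exact: oversparse_pair.
have gKL : g \in K :&: L by rewrite inE gK.
move=> KL1; apply: oversparse_join => //.
have -> : #|K :&: L| = 1.
  by apply/eqP; rewrite eqn_leq KL1 card_gt0; apply/set0Pn; exists g.
have gu : g :|: u \subset cover K :&: cover L.
  by rewrite subsetI !subUset (sub_cover gK) (sub_cover gL) (subset_trans ue (sub_cover eK))
    (subset_trans uf (sub_cover fL)).
rewrite mul1n -/r; apply: leq_trans (subset_leq_card gu); rewrite -(uK g gK).
apply: proper_card; rewrite properE subsetUl subUset negb_and ug orbT //.
Qed.

(* Two conflicts with a common edge have a sparse union, and a second common edge
   makes the union oversparse.  What remains is [K1 = [set e; g]] and
   [K2 = [set f; g]], where [g] meets the span of [K] in more than [t] vertices. *)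
Lemma bad_cycle_geom e f g K K1 K2 : conflict K -> conflict K1 ->
  conflict K2 -> 2 < #|K| -> e \in K -> f \in K -> e != f -> g != e ->
  g != f -> e \in K1 -> g \in K1 -> f \in K2 -> g \in K2 -> f \notin K1 ->
  e \notin K2 -> oversparse (K :|: K1 :|: K2).
Proof.
move=> cK cK1 cK2 K3 eK fK ef ge gf eK1 gK1 fK2 gK2 fK1 eK2.
have memI (A B : {set {set T}}) a : a \in A -> a \in B -> 0 < #|A :&: B|.
  by move=> aA aB; rewrite card_gt0; apply/set0Pn; exists a; rewrite inE aA.
have memI2 (A B : {set {set T}}) a b : a != b -> a \in A -> a \in B -> b \in A ->
    b \in B -> 1 < #|A :&: B|.
  by move=> ab aA aB bA bB; apply/card_gt1P; exists a, b; rewrite !inE aA bA.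
have KK1 : K != K1 by apply: contraNneq fK1 => <-.
have KK2 : K != K2 by apply: contraNneq eK2 => <-.
have K12 : K1 != K2 by apply: contraNneq fK1 => ->.
have [I1|I1] := ltnP 1 #|K :&: K1|.
  apply: oversparse_grow => //; first exact: oversparse_pair.
  by apply: (memI _ _ f) => //; rewrite inE fK.
have [I2|I2] := ltnP 1 #|K :&: K2|.
  rewrite -setUA [K1 :|: K2]setUC setUA.
  apply: oversparse_grow => //; first exact: oversparse_pair.
  by apply: (memI _ _ e) => //; rewrite inE eK.
have [I3|I3] := ltnP 1 #|K1 :&: K2|.
  rewrite -setUA setUC; apply: oversparse_grow => //; first exact: oversparse_pair.
  by apply: (memI _ _ e) => //; rewrite inE eK1.
have [uK _ _ sK _] := conflictP cK; have [uK1 K1_2 _ _ _] := conflictP cK1.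
have [uK2 K2_2 _ _ _] := conflictP cK2.
(* If [K2] is not inside [K :|: K1], then [f] and [g] are two edges it shares with this sparse
   union. *)
have [s2|n2] := boolP (K2 \subset K :|: K1); last first.
  apply: oversparse_proper => //.
    by apply: sparse_grow => //; apply: (memI _ _ e).
  by apply: (memI2 _ _ f g); rewrite 1?eq_sym // inE ?fK ?gK1 ?orbT.
have [s1|n1] := boolP (K1 \subset K :|: K2); last first.
  rewrite -setUA [K1 :|: K2]setUC setUA.
  apply: oversparse_proper => //.
    by apply: sparse_grow => //; apply: (memI _ _ f).
  by apply: (memI2 _ _ e g); rewrite 1?eq_sym // inE ?eK ?gK2 ?orbT.
have only (A B C : {set {set T}}) a b : #|A :&: C| <= 1 -> #|B :&: C| <= 1 ->
    C \subset A :|: B -> a \in A -> a \in C -> b \in B -> b \in C -> C = [set a; b].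
  move=> AC BC sC aA aC bB bC; apply/eqP; rewrite eqEsubset subUset !sub1set aC bC /= andbT.
  apply/subsetP => c cC; rewrite !inE.
  have := subsetP sC c cC; rewrite inE => /orP[cA|cB]; apply/orP; [left|right]; apply/eqP.
    by apply: (card_le1_eqP AC); rewrite inE ?cA ?aA.
  by apply: (card_le1_eqP BC); rewrite inE ?cB ?bB.
have K2E : K2 = [set f; g] by apply: (only K K1).
have K1E : K1 = [set e; g] by apply: (only K K2) => //; rewrite setIC.
have gK : g \notin K.
  by apply/negP => gK; move: I1; rewrite leqNgt (memI2 _ _ e g) // eq_sym.
have te : t <= #|g :&: e|.
  rewrite -sparse_share //; [|exact: uK1|exact: uK].
  have [_ _ _ sK1 _] := conflictP cK1.
  by rewrite setUC -K1E.
have tf : t <= #|g :&: f|.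
  rewrite -sparse_share //; [|exact: uK1|exact: uK].
  have [_ _ _ sK2 _] := conflictP cK2.
  by rewrite setUC -K2E.
have -> : K :|: K1 :|: K2 = g |: K.
  rewrite K1E K2E; apply/setP => c; rewrite !inE.
  have ceK : (c == e) ==> (c \in K) by apply/implyP => /eqP ->.
  have cfK : (c == f) ==> (c \in K) by apply/implyP => /eqP ->.
  by move: ceK cfK; case: (c == e); case: (c == f); case: (c == g); case: (c \in K).
rewrite /oversparse cardsU1 gK /cover bigcup_setU big_set1 -/(cover K).
have gE := uK1 g gK1.
have arith x y b k : x + y = d + t + b -> t < y -> b <= k * d + t -> x < (1 + k) * d + t.
  by clear; rewrite mulnDl mul1n; lia.
have : #|(g :&: e) :|: (g :&: f)| <= #|g :&: cover K|.
  by apply: subset_leq_card; rewrite -setIUr; apply: setIS; rewrite subUset !sub_cover.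
have [lt|ge'] := ltnP t #|(g :&: e) :|: (g :&: f)|.
  move=> le; apply: (arith _ #|g :&: cover K| #|cover K| #|K|) sK.
    by rewrite cardsUI gE.
  exact: leq_trans lt le.
move=> _.
(* Equality case: [g] meets [e] and [f] in the same [t] vertices, so [e] and [f] share [t] vertices
   and [K] would have only two edges. *)
have eqge : g :&: e = (g :&: e) :|: (g :&: f).
  by apply/eqP; rewrite eqEcard subsetUl /= (leq_trans ge').
have eqgf : g :&: f = (g :&: e) :|: (g :&: f).
  by apply/eqP; rewrite eqEcard subsetUr /= (leq_trans ge').
have tef : t <= #|e :&: f|.
  apply: leq_trans te _; apply: subset_leq_card.
  by rewrite subsetI subsetIr {1}eqge -eqgf subsetIr.
by move: K3; rewrite (conflict_share cK eK fK ef tef) cards2 ef.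
Qed.

(** Passing to smaller sparse subfamilies ends in a conflict; hence avoiding conflicts is enough to
    avoid four sparse edges. *)
Lemma conflict_sub F : uniform F -> 1 < #|F| -> #|F| <= 4 -> sparse F ->
  exists2 K, conflict K & K \subset F.
Proof.
move=> /forallP uF; elim: {F}_.+1 {-2}F (ltnSn #|F|) uF => // n IH F ltn uF F1 F4 sF.
have [cF|] := boolP (conflict F); first by exists F.
rewrite /conflict F1 F4 sF /= negb_and; case/orP.
  by move=> /forallPn[e]; rewrite uF.
case/forallPn=> L; rewrite powersetE !negb_imply => /and3P[LF /andP[L1 sL] LneF].
have LltF : #|L| < #|F| by apply: proper_card; rewrite properEneq LneF.
have [|||K cK KL] := IH L _ _ L1 _ sL.
- exact: leq_trans LltF _.
- move=> e; have := uF e; case: (boolP (e \in L)) => //= eL.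
  by rewrite (subsetP LF).
- exact: leq_trans (ltnW LltF) F4.
by exists K => //; apply: subset_trans LF.
Qed.

End Sparse.

(** * The upper bound *)

(** Induction on [j] with Pascal's rule: each step adds a binomial coefficient to both sides, and
    the one on the right is strictly larger because its upper index exceeds the other by [d]. *)
Lemma bin_gap t d j : 1 < t -> 0 < d ->
  'C(t + j, t) + 'C(d + t, t) + j <= 'C(d + t + j, t) + 1.
Proof.
case: t => // t t1 d0; elim: j => [|j IH]; first by rewrite !addn0 binn addnC.
have lt : 'C(t.+1 + j, t) < 'C(d + t.+1 + j, t).
  have -> : d + t.+1 + j = (d.-1 + (t.+1 + j)).+1 by lia.
  move: t1 (leq_bin2l t (leq_addl d.-1 (t.+1 + j))).
  case: t {IH} => // t' _ le; rewrite binS -addn1; apply: leq_add => //.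
  by rewrite bin_gt0; lia.
rewrite [t.+1 + j.+1]addnS [d + t.+1 + j.+1]addnS (binS (t.+1 + j)) (binS (d + t.+1 + j)).
move: IH lt; clear; lia.
Qed.

(* The only place where [r >= 4] matters: equality holds for [r = 3], [t = 2]. *)
Lemma double_bin_lt t d : 1 < t -> 0 < d -> 3 < d + t ->
  2 * 'C(d + t, t) < 'C(2 * d + t, t).
Proof.
move=> t1 d0 dt; case: (ltnP 1 d) => d1.
  have := bin_gap d t1 d0; rewrite (_ : d + t + d = 2 * d + t); last by lia.
  by rewrite [t + d]addnC; lia.
(* The surplus [d - 1] from [bin_gap] is now zero, and the claim is
   [2 * (t + 1) < (t + 2) * (t + 1) / 2], true from [t = 3] on. *)
have -> : d = 1 by lia.
have t3 : 2 < t by lia.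
rewrite muln1 !addSn !add0n binSn -(bin_sub (leqW (leqW (leqnn t)))).
rewrite (_ : t.+2 - t = 2); last by lia.
rewrite bin2 -divn2 leq_divRL //; move: t3; clear; nia.
Qed.

Section Upper.
Variables (T : finType) (t d : nat).
Hypothesis t2 : 1 < t.
Hypothesis d0 : 0 < d.
Let r := (d + t)%N.
Implicit Types (E F G P Q : {set {set T}}) (e f g u v : {set T}).

Definition four_free E := forall F, F \subset E -> #|F| = 4 -> ~~ sparse t d F.

Lemma sparse_add F g : #|g| = r -> g \notin F -> sparse t d F ->
  t <= #|g :&: cover F| -> sparse t d (g |: F).
Proof.
move=> gr gF; rewrite /sparse cardsU1 gF /cover bigcup_setU big_set1 -/(cover F).
have := cardsUI g (cover F); rewrite gr /r mulnDl; move: d0; clear; lia.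
Qed.

(** A span that is short by [k] makes up for an intersection that is short by [k]. *)
Lemma oversparse_add F g k : #|g| = r -> g \notin F -> #|cover F| + k <= #|F| * d + t ->
  t <= #|g :&: cover F| + k -> sparse t d (g |: F).
Proof.
move=> gr gF; rewrite /sparse cardsU1 gF /cover bigcup_setU big_set1 -/(cover F).
have := cardsUI g (cover F); rewrite gr /r mulnDl; clear; lia.
Qed.

Lemma sparse_disjointU F G : [disjoint F & G] -> sparse t d F -> sparse t d G ->
  t <= #|cover F :&: cover G| -> sparse t d (F :|: G).
Proof.
move=> dFG sF sG h; apply: sparse_join => //.
by move: dFG; rewrite -setI_eq0 => /eqP ->; rewrite cards0 mul0n.
Qed.

(** * Counting [t]-sets when no pair or triple is oversparse *)

Section Good.
Variable E : {set {set T}}.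
Hypothesis Er : forall e, e \in E -> #|e| = r.
Hypothesis free : four_free E.
Hypothesis tight : forall F, F \subset E -> 1 < #|F| -> #|F| <= 3 -> ~~ oversparse t d F.

Definition pairs := [set P : {set {set T}} | [&& P \subset E, #|P| == 2 & sparse t d P]].

Definition degree e := #|[set P in pairs | e \in P]|.

Definition edges_over u := [set e in E | u \subset e].

Definition pairs_over u := [set P in pairs | u \subset cover P].

(* The collisions between the claim of a pair and that of an edge of degree 0:
   there is at most one such [u] for each pair, and the strictness of
   [double_bin_lt] pays for it. *)
Definition crossed u := [set P in pairs_over u |
  [exists g in E, [&& g \notin P, degree g == 0 & u \subset g]]].

Lemma pairsP P : P \in pairs -> [/\ P \subset E, #|P| = 2, sparse t d P & #|cover P| = 2 * d + t].
Proof.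
rewrite inE => /and3P[PE /eqP P2 sP]; split=> //; apply/eqP; rewrite eqn_leq.
have := tight PE; rewrite P2 => /(_ isT isT); rewrite /oversparse -leqNgt P2 => ->.
by move: sP; rewrite /sparse P2 => ->.
Qed.

Lemma pairs_overP u P : P \in pairs_over u -> P \in pairs /\ u \subset cover P.
Proof. by rewrite inE => /andP[]. Qed.

Lemma mem_pairs e f : e \in E -> f \in E -> e != f -> t <= #|e :&: f| ->
  [set e; f] \in pairs.
Proof.
move=> eE fE ef tef; rewrite inE subUset !sub1set eE fE cards2 ef /=.
by rewrite sparse_share //; apply: Er.
Qed.

Lemma degree_gt0 e P : P \in pairs -> e \in P -> 0 < degree e.
Proof. by move=> Pp eP; rewrite card_gt0; apply/set0Pn; exists P; rewrite inE Pp. Qed.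

Lemma degree_gt1 e P Q : P \in pairs -> Q \in pairs -> P != Q -> e \in P -> e \in Q ->
  1 < degree e.
Proof.
move=> Pp Qp PQ eP eQ; apply/card_gt1P; exists P, Q.
by rewrite !inE; move: Pp Qp; rewrite !inE => -> ->; rewrite eP eQ.
Qed.

Lemma share_of_over u (A B : {set T}) : #|u| = t -> u \subset A -> u \subset B -> t <= #|A :&: B|.
Proof. by move=> <- uA uB; apply: subset_leq_card; rewrite subsetI uA. Qed.

(** Disjoint pairs over [u] would form four edges, sparse because their spans share the [t] vertices
    of [u]. *)
Lemma pairs_over_meet u P Q : #|u| = t -> P \in pairs_over u -> Q \in pairs_over u ->
  P :&: Q != set0.
Proof.
move=> ut /pairs_overP[Pp uP] /pairs_overP[Qp uQ].
have [PE P2 sP _] := pairsP Pp; have [QE Q2 sQ _] := pairsP Qp.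
apply/eqP => dPQ; have PQE : P :|: Q \subset E by rewrite subUset PE.
have PQ4 : #|P :|: Q| = 4 by rewrite cardsU dPQ cards0 P2 Q2.
case/negP: (free PQE PQ4); apply: sparse_disjointU => //.
  by rewrite -setI_eq0 dPQ.
exact: share_of_over uP uQ.
Qed.

Lemma pair_meet_card P Q : #|P| = 2 -> #|Q| = 2 -> P != Q -> P :&: Q != set0 ->
  #|P :&: Q| = 1 /\ #|P :|: Q| = 3.
Proof.
move=> P2 Q2 PQ; rewrite -card_gt0 => I0.
have I1 : #|P :&: Q| = 1.
  apply/eqP; rewrite eqn_leq I0 andbT leqNgt; apply: contra PQ => I2.
  have PI : P :&: Q = P by apply/eqP; rewrite eqEcard subsetIl P2.
  have QI : P :&: Q = Q by apply/eqP; rewrite eqEcard subsetIr Q2.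
  by apply/eqP; rewrite -{1}PI QI.
by split=> //; rewrite cardsU P2 Q2 I1.
Qed.

(** The spans of [P] and [Q] meet exactly in their common edge, as a larger intersection would make
    the triple oversparse, against [tight]. Hence that edge contains [u], and it lies in two
    pairs. *)
Lemma pairs_over_center u P Q : #|u| = t -> P \in pairs_over u -> Q \in pairs_over u ->
  P != Q -> exists e, [/\ e \in P, e \in Q, e \in edges_over u & 1 < degree e] /\
  sparse t d (P :|: Q).
Proof.
move=> ut PD QD PQ; have := pairs_over_meet ut PD QD; move: PD QD.
move=> /pairs_overP[Pp uP] /pairs_overP[Qp uQ] I0.
have [PE P2 sP cP] := pairsP Pp; have [QE Q2 sQ cQ] := pairsP Qp.
have [I1 U3] := pair_meet_card P2 Q2 PQ I0.
have /cards1P[e IE] : #|P :&: Q| == 1 by rewrite I1.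
have : e \in P :&: Q by rewrite IE inE.
rewrite inE => /andP[eP eQ]; have eE := subsetP PE e eP.
have ec : e \subset cover P :&: cover Q by rewrite subsetI !sub_cover.
have sU : sparse t d (P :|: Q).
  by apply: sparse_join => //; rewrite I1 mul1n -/r -(Er eE); apply: subset_leq_card.
have cU : 3 * d + t <= #|cover (P :|: Q)|.
  have := @tight (P :|: Q); rewrite subUset PE QE U3 => /(_ isT isT isT).
  by rewrite /oversparse U3 -leqNgt.
have ceq : e = cover P :&: cover Q.
  apply/eqP; rewrite eqEcard ec (Er eE) /r /=.
  have := cardsUI (cover P) (cover Q); rewrite -coverU cP cQ.
  by move: cU; clear; lia.
exists e; split=> //; split=> //; last exact: degree_gt1 Pp Qp PQ eP eQ.
by rewrite inE eE ceq subsetI uP uQ.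
Qed.

Lemma degree_sum_ge u (C : {set {set T}}) : C \subset edges_over u ->
  (forall e, e \in edges_over u -> 0 < degree e) -> (forall e, e \in C -> 1 < degree e) ->
  #|edges_over u| + #|C| <= \sum_(e in edges_over u) degree e.
Proof.
move=> CA deg1 deg2; rewrite -(setIidPr CA) -!sum1_card.
rewrite [\sum_(i in _ :&: C) 1]big_mkcond [\sum_(i in edges_over u) 1]big_mkcond.
rewrite [X in _ <= X]big_mkcond -big_split; apply: leq_sum => e _ /=.
rewrite in_setI; case: (boolP (e \in edges_over u)) => //= eA.
by case: (boolP (e \in C)) => eC; rewrite ?addn0 ?addn1 ?deg1 ?deg2.
Qed.

(** An edge over [u] of degree 0 is the only edge over [u], and then every pair over [u] is crossed.
    Otherwise all these degrees are positive; two pairs have a center of degree at least 2, three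
    pairs have two such centers, and more than three pairs do not occur. *)
Lemma local_count u : #|u| = t -> #|edges_over u| + #|pairs_over u| <=
  1 + \sum_(e in edges_over u) degree e + #|crossed u|.
Proof.
move=> ut; have [g /andP[gA g0]|deg0] := pickP (fun g => (g \in edges_over u) && (degree g == 0)).
  have [gE ug] : g \in E /\ u \subset g by move: gA; rewrite inE => /andP[].
  have -> : edges_over u = [set g].
    apply/eqP; rewrite eqEsubset sub1set gA andbT; apply/subsetP => e.
    rewrite !inE => /andP[eE ue]; apply: contraLR g0 => eg; rewrite -lt0n.
    by apply: (degree_gt0 (mem_pairs eE gE eg (share_of_over ut ue ug))); rewrite !inE eqxx orbT.
  rewrite cards1 -addnA leq_add2l; apply: leq_trans (leq_addl _ _).
  apply: subset_leq_card; apply/subsetP => P PD; rewrite inE PD /=.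
  apply/existsP; exists g; rewrite gE ug g0 /= andbT.
  by apply: contraL g0 => gP; rewrite -lt0n; apply: degree_gt0 (pairs_overP PD).1 gP.
have deg1 e : e \in edges_over u -> 0 < degree e.
  by move=> eA; rewrite lt0n; have := deg0 e; rewrite eA /= => ->.
apply: leq_trans (leq_addr _ _).
have [D1|] := leqP #|pairs_over u| 1.
  have := @degree_sum_ge u set0; rewrite sub0set cards0 addn0 => /(_ isT deg1) le.
  by rewrite addnC leq_add // le // => e; rewrite inE.
move=> /card_gt1P[P [Q [PD QD PQ]]].
have [e [[eP eQ eA e2] sPQ]] := pairs_over_center ut PD QD PQ.
have [Pp uP] := pairs_overP PD.
have [Qp uQ] := pairs_overP QD.
have [PE P2 sP cP] := pairsP Pp; have [QE Q2 sQ cQ] := pairsP Qp.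
have [I1 U3] := pair_meet_card P2 Q2 PQ (pairs_over_meet ut PD QD).
(* A pair [R] outside [P :|: Q] still meets [P], so it shares exactly one edge with the union, and
   the four edges together are sparse. *)
have inU R : R \in pairs_over u -> R \subset P :|: Q.
  move=> RD; apply: contraT => RU.
  have [Rp uR] := pairs_overP RD.
  have [RE R2 sR cR] := pairsP Rp.
  have RP : R != P by apply: contraNneq RU => ->; apply: subsetUl.
  have RI : 0 < #|(P :|: Q) :&: R|.
    apply: leq_trans (subset_leq_card (setSI R (subsetUl P Q))).
    by rewrite card_gt0 (pairs_over_meet ut).
  have RI1 : #|(P :|: Q) :&: R| = 1.
    apply/eqP; rewrite eqn_leq RI andbT leqNgt; apply: contra RU => RI2.
    have RE2 : (P :|: Q) :&: R = R by apply/eqP; rewrite eqEcard subsetIr R2.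
    by rewrite -RE2 subsetIl.
  have WE : (P :|: Q) :|: R \subset E by rewrite !subUset PE QE.
  have W4 : #|(P :|: Q) :|: R| = 4 by rewrite cardsU U3 R2 RI1.
  case/negP: (free WE W4).
  apply: sparse_join => //; have /cards1P[f fI] : #|(P :|: Q) :&: R| == 1 by rewrite RI1.
  have : f \in (P :|: Q) :&: R by rewrite fI inE.
  rewrite inE => /andP[fU fR]; rewrite RI1 mul1n -/r -(Er (subsetP RE f fR)).
  by apply: subset_leq_card; rewrite subsetI !sub_cover.
have [D2|D3] := leqP #|pairs_over u| 2.
  have := @degree_sum_ge u [set e]; rewrite sub1set cards1 => /(_ eA deg1) le.
  have : #|edges_over u| + 1 <= \sum_(e in edges_over u) degree e.
    by apply: le => f; rewrite inE => /eqP ->.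
  by move: D2; clear; lia.
have D3' : #|pairs_over u| <= 3.
  have -> : 3 = 'C(#|P :|: Q|, 2) by rewrite U3.
  rewrite -cards_draws; apply: subset_leq_card; apply/subsetP => R RD.
  by have [_ R2 _ _] := pairsP (pairs_overP RD).1; rewrite inE inU //= R2.
have [R RD /andP[RP RQ]] : exists2 R, R \in pairs_over u & (R != P) && (R != Q).
  have : 0 < #|pairs_over u :\: [set P; Q]|.
    rewrite cardsD subn_gt0; apply: leq_ltn_trans D3.
    apply: leq_trans (subset_leq_card (subsetIr _ _)) _.
    by rewrite cards2; case: (_ != _).
  by rewrite card_gt0 => /set0Pn[R]; rewrite in_setD in_set2 negb_or => /andP[neq RD]; exists R.
have PR : P != R by rewrite eq_sym.
have [f [[fP fR fA f2] _]] := pairs_over_center ut PD RD PR.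
have [_ R2 _ _] := pairsP (pairs_overP RD).1.
(* If the centers agreed, [R] would be [e] with another edge of [P :|: Q], that is [P] or [Q]. *)
have ef : e != f.
  apply: contraNneq RP => efE; rewrite -efE in fR.
  have /cards1P[x xR] : #|R :\ e| == 1.
    by move: R2; rewrite (cardsD1 e) fR add1n => -[->].
  have RE : R = e |: [set x] by rewrite -xR setD1K.
  have xU : x \in P :|: Q by apply: (subsetP (inU R RD)); rewrite RE !inE eqxx orbT.
  move: xU; rewrite inE => /orP[xP|xQ].
    by rewrite eqEcard R2 P2 andbT RE subUset !sub1set eP.
  by case/eqP: RQ; apply/eqP; rewrite eqEcard R2 Q2 andbT RE subUset !sub1set eQ.
have := @degree_sum_ge u [set e; f]; rewrite cards2 ef => le.
have : #|edges_over u| + 2 <= \sum_(e in edges_over u) degree e.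
  apply: le => // [|k]; first by rewrite subUset !sub1set eA.
  by rewrite !inE => /orP[] /eqP ->.
by move: D3'; clear; lia.
Qed.

(** The edge outside [P] that contains [u] is unique, since a second one would complete four sparse
    edges. By [tight] it meets the span of [P] in only [t] vertices, so [u] is that intersection. *)
Lemma crossed_inj P u u' : #|u| = t -> #|u'| = t -> P \in crossed u -> P \in crossed u' ->
  u = u'.
Proof.
move=> ut ut'; rewrite inE => /andP[/pairs_overP[Pp uP]].
case/existsP=> g /and4P[gE gP g0 ug]; rewrite inE => /andP[/pairs_overP[_ uP']].
case/existsP=> g' /and4P[g'E g'P g'0 ug'].
have [PE P2 sP cP] := pairsP Pp.
have sg : sparse t d (g |: P).
  by apply: sparse_add => //; [apply: Er | apply: share_of_over ug uP].
have gPE : g |: P \subset E by rewrite subUset sub1set gE.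
have [gg'|gg'] := eqVneq g g'; last first.
  have WE : g' |: (g |: P) \subset E by rewrite subUset sub1set g'E.
  have g'W : g' \notin g |: P by rewrite !inE negb_or eq_sym gg'.
  have W4 : #|g' |: (g |: P)| = 4 by rewrite !cardsU1 g'W gP P2.
  case/negP: (free WE W4); apply: sparse_add => //; first exact: Er.
  apply: share_of_over ut' ug' (subset_trans uP' _).
  exact: cover_sub (subsetUr _ _).
have lt : #|g :&: cover P| <= t.
  have := tight gPE; rewrite cardsU1 gP P2 => /(_ isT isT).
  rewrite /oversparse cardsU1 gP P2 /cover bigcup_setU big_set1 -/(cover P).
  have := cardsUI g (cover P); rewrite (Er gE) cP /r; clear; lia.
have only v : #|v| = t -> v \subset g -> v \subset cover P -> v = g :&: cover P.
  by move=> vt vg vP; apply/eqP; rewrite eqEcard subsetI vg vP vt.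
by rewrite (only u) // (only u') // gg'.
Qed.

Let tsets := [set u : {set T} | #|u| == t].

Lemma sum_over (A : {set {set {set T}}}) : \sum_(u in tsets) #|[set P in A | u \subset cover P]| =
  \sum_(P in A) 'C(#|cover P|, t).
Proof.
transitivity (\sum_(u in tsets) \sum_(P in A | u \subset cover P) 1).
  by apply: eq_bigr => u _; rewrite -sum1_card; apply: eq_bigl => P; rewrite inE.
rewrite (exchange_big_dep (mem A)) /=; last by move=> u P _ /andP[].
apply: eq_bigr => P PA; rewrite -cards_draws -sum1_card; apply: eq_bigl => u.
by rewrite !inE PA andbC.
Qed.

Lemma sum_edges_over (f : {set T} -> nat) :
  \sum_(u in tsets) \sum_(e in edges_over u) f e = 'C(r, t) * \sum_(e in E) f e.
Proof.
rewrite big_distrr (exchange_big_dep (mem E)) /=; last by move=> u e _; rewrite inE => /andP[].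
apply: eq_bigr => e eE; rewrite sum_nat_const -(Er eE) -cards_draws; congr (_ * _).
by rewrite -[RHS]sum1_card -sum1_card; apply: eq_bigl => u; rewrite unfold_in !inE eE andbC.
Qed.

Lemma sum_degree : \sum_(e in E) degree e = 2 * #|pairs|.
Proof.
transitivity (\sum_(e in E) \sum_(P in pairs | e \in P) 1).
  by apply: eq_bigr => e _; rewrite /degree -sum1_card; apply: eq_bigl => P; rewrite inE.
rewrite (exchange_big_dep (mem pairs)) /=; last by move=> e P _ /andP[].
rewrite mulnC -sum_nat_const; apply: eq_bigr => P Pp; have [PE <- _ _] := pairsP Pp.
rewrite -sum1_card; apply: eq_bigl => e; rewrite Pp /=.
by case: (boolP (e \in P)) => eP; rewrite ?andbF // (subsetP PE).
Qed.

(** Sums [local_count] over all [t]-sets. With [p] pairs, degrees contribute [2 * p * 'C(r, t)] and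
    crossings at most [p], while the pairs themselves claim [p * 'C(2 * d + t, t)]; [double_bin_lt]
    makes the latter prevail. *)
Lemma good_card : 3 < d + t -> #|E| * 'C(r, t) <= 'C(#|T|, t).
Proof.
move=> dt.
have le : \sum_(u in tsets) (#|edges_over u| + #|pairs_over u|) <=
    \sum_(u in tsets) (1 + \sum_(e in edges_over u) degree e + #|crossed u|).
  by apply: leq_sum => u; rewrite inE => /eqP; apply: local_count.
have crossed_le : \sum_(u in tsets) #|crossed u| <= #|pairs|.
  have -> : \sum_(u in tsets) #|crossed u| = \sum_(u in tsets) \sum_(P in pairs | P \in crossed u) 1.
    apply: eq_bigr => u _; rewrite -sum1_card; apply: eq_bigl => P.
    by case: (boolP (P \in crossed u)); rewrite ?andbF // inE => /andP[/pairs_overP[->]].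
  rewrite (exchange_big_dep (mem pairs)) /=; last by move=> u P _ /andP[].
  rewrite -sum1_card; apply: leq_sum => P Pp.
  rewrite sum1_card; apply/card_le1_eqP => u u'.
  move=> /andP[ut /andP[_ uc]] /andP[ut' /andP[_ uc']].
  by move: ut ut'; rewrite !inE => /eqP ut /eqP ut'; apply: crossed_inj ut' ut uc' uc.
move: le; rewrite !big_split /= sum_edges_over sum_degree.
have -> : \sum_(u in tsets) #|edges_over u| = 'C(r, t) * #|E|.
  rewrite -[#|E|]sum1_card -sum_edges_over; apply: eq_bigr => u _.
  by rewrite sum1_card.
have -> : \sum_(u in tsets) #|pairs_over u| = #|pairs| * 'C(2 * d + t, t).
  rewrite sum_over -sum_nat_const; apply: eq_bigr => P Pp.
  by have [_ _ _ ->] := pairsP Pp.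
have -> : \sum_(u in tsets) 1 = 'C(#|T|, t) by rewrite sum1_card card_draws.
move: crossed_le (double_bin_lt t2 d0 dt); rewrite -/r.
move: (\sum_(_ in _) _) #|pairs| 'C(2 * d + t, t) 'C(r, t) #|E| 'C(#|T|, t) => a p x y m z.
clear; nia.
Qed.

End Good.

(** * Edges in oversparse pairs or triples are few *)

Section Exceptional.
Variable E : {set {set T}}.
Hypothesis Er : forall e, e \in E -> #|e| = r.
Hypothesis free : four_free E.

Definition exceptional := [set e in E | [exists F : {set {set T}},
  [&& F \subset E, 1 < #|F|, #|F| <= 3, oversparse t d F & e \in F]]].

Lemma exceptionalP e : e \in exceptional -> e \in E /\ exists F : {set {set T}},
  [/\ F \subset E, #|F| = 2 \/ #|F| = 3, oversparse t d F & e \in F].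
Proof.
rewrite inE => /andP[eE /existsP[F /and5P[FE F2 F3 oF eF]]]; split=> //; exists F; split=> //.
by move: F2 F3; case: #|F| => [|[|[|[|]]]] // _ _; [left|right].
Qed.

Section Over.
Variable v : {set T}.
Hypothesis vt : #|v| = t.-1.

Let bad_over := [set e in exceptional | v \subset e].

Let bad_overP e : e \in bad_over -> [/\ e \in exceptional, e \in E & v \subset e].
Proof.
rewrite inE => /andP[eB ve]; split=> //; by have [] := exceptionalP eB.
Qed.

Let cover_v F e : e \in F -> v \subset e -> v \subset cover F.
Proof. by move=> eF ve; apply: subset_trans ve (sub_cover eF). Qed.

Let triple_absorbs F e : F \subset E -> #|F| = 3 -> oversparse t d F -> e \in F ->
  v \subset e -> #|bad_over| <= 3.
Proof.
move=> FE F3 oF eF ve; rewrite -F3; apply: subset_leq_card.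
apply/subsetP => g /bad_overP[_ gE vg].
apply: contraT => gF; have WE : g |: F \subset E by rewrite subUset sub1set gE.
have W4 : #|g |: F| = 4 by rewrite cardsU1 gF F3.
case/negP: (free WE W4); apply: (@oversparse_add _ _ 1) => //; first exact: Er.
  by move: oF; rewrite /oversparse addn1.
have : #|v| <= #|g :&: cover F|.
  by apply: subset_leq_card; rewrite subsetI vg (cover_v eF).
by rewrite vt; move: t2; clear; lia.
Qed.

(** An oversparse triple with an edge over [v] admits no fourth edge over [v]: its span is one
    short, and [v] has [t - 1] elements. Two oversparse pairs over [v] are either disjoint, giving
    four sparse edges, or share an edge and form an oversparse triple. *)
Lemma exceptional_over : #|bad_over| <= 3.
Proof.
have [->|/set0Pn[e eB]] := eqVneq bad_over set0; first by rewrite cards0.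
have [eX eE ve] := bad_overP eB; have [_ [F [FE F23 oF eF]]] := exceptionalP eX.
case: F23 => [F2|F3]; last exact: triple_absorbs FE F3 oF eF ve.
have [sBF|/subsetPn[g gB gF]] := boolP (bad_over \subset F).
  by apply: leq_trans (subset_leq_card sBF) _; rewrite F2.
have [gX gE vg] := bad_overP gB; have [_ [G [GE G23 oG gG]]] := exceptionalP gX.
case: G23 => [G2|G3]; last exact: triple_absorbs GE G3 oG gG vg.
have FG : F != G by apply: contraNneq gF => ->.
have UE : F :|: G \subset E by rewrite subUset FE.
have := cardsUI (cover F) (cover G); rewrite -coverU.
have [dFG|I0] := eqVneq (F :&: G) set0.
  have U4 : #|F :|: G| = 4 by rewrite cardsU dFG cards0 F2 G2.
  have : #|v| <= #|cover F :&: cover G|.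
    by apply: subset_leq_card; rewrite subsetI (cover_v eF ve) (cover_v gG vg).
  have := free UE U4; move: oF oG; rewrite /oversparse /sparse F2 G2 U4 vt.
  by move: t2; clear; lia.
have [I1 U3] := pair_meet_card F2 G2 FG I0.
have /cards1P[k kI] : #|F :&: G| == 1 by rewrite I1.
have : k \in F :&: G by rewrite kI inE.
rewrite inE => /andP[kF kG].
have : #|k| <= #|cover F :&: cover G|.
  by apply: subset_leq_card; rewrite subsetI !sub_cover.
rewrite (Er (subsetP FE k kF)) => le eq.
apply: (triple_absorbs UE U3 _ _ ve); last by rewrite inE eF.
move: oF oG le eq; rewrite /oversparse F2 G2 U3 /r; clear; lia.
Qed.

End Over.

Lemma exceptional_card : t <= r -> #|exceptional| <= 3 * 'C(#|T|, t.-1).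
Proof.
move=> tr; pose vs := [set v : {set T} | #|v| == t.-1].
have : \sum_(v in vs) #|[set e in exceptional | v \subset e]| <= \sum_(v in vs) 3.
  by apply: leq_sum => v; rewrite inE => /eqP; apply: exceptional_over.
rewrite sum_nat_const card_draws mulnC; apply: leq_trans.
have -> : \sum_(v in vs) #|[set e in exceptional | v \subset e]| =
    \sum_(e in exceptional) 'C(r, t.-1).
  transitivity (\sum_(v in vs) \sum_(e in exceptional | v \subset e) 1).
    by apply: eq_bigr => v _; rewrite -sum1_card; apply: eq_bigl => e; rewrite inE.
  rewrite (exchange_big_dep (mem exceptional)) /=; last by move=> v e _ /andP[].
  apply: eq_bigr => e eB; have [eE _] := exceptionalP eB.
  rewrite -(Er eE) -cards_draws -sum1_card; apply: eq_bigl => v.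
  by rewrite eB !inE andbC.
by rewrite sum_nat_const leq_pmulr // bin_gt0 (leq_trans (leq_pred t)).
Qed.

Lemma four_free_card : 3 < d + t ->
  #|E| * 'C(r, t) <= 'C(#|T|, t) + 3 * 'C(#|T|, t.-1) * 'C(r, t).
Proof.
move=> dt; have tr : t <= r by rewrite /r leq_addl.
have DE : E :\: exceptional \subset E by apply: subsetDl.
have := @good_card (E :\: exceptional) _ _ _ dt.
rewrite -(cardsID exceptional E) mulnDl addnC => le; apply: leq_add.
  apply: le => [e|F FD F4|F FD F2 F3].
  - by rewrite inE => /andP[_ /Er].
  - exact: free (subset_trans FD DE) F4.
  apply/negP => oF; have /card_gt0P[e eF] : 0 < #|F| by apply: ltnW.
  have := subsetP FD e eF; rewrite in_setD => /andP[/negP eB eE].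
  apply: eB; rewrite inE eE; apply/existsP; exists F.
  by rewrite (subset_trans FD DE) F2 F3 oF eF.
rewrite leq_mul2r; apply/orP; right; apply: leq_trans (exceptional_card tr).
by apply: subset_leq_card; apply: subsetIr.
Qed.

End Exceptional.
End Upper.

(** * Counting families with small span; binomial estimates *)

Lemma card_families n M : 0 < n ->
  #|[set F : {set {set 'I_n}} | #|cover F| <= M]| <= n ^ M * 2 ^ 2 ^ M.
Proof.
case: n => // n _.
(* A family spanning at most [M] vertices is the image, under a map from ['I_M] to the vertices, of
   a family of subsets of ['I_M]. *)
pose img (a : {ffun 'I_M -> 'I_n.+1} * {set {set 'I_M}}) : {set {set 'I_n.+1}} :=
  [set a.1 @: (A : {set 'I_M}) | A in a.2].
apply: (@leq_trans #|[set img a | a in [set: {ffun 'I_M -> 'I_n.+1} * {set {set 'I_M}}]]|); last first.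
  apply: leq_trans (leq_imset_card _ _) _.
  rewrite cardsT card_prod card_ffun !card_ord -cardsT.
  by rewrite -powersetT card_powerset cardsT -cardsT -powersetT card_powerset cardsT card_ord.
apply: subset_leq_card; apply/subsetP => F; rewrite inE => FM.
pose phi := [ffun i : 'I_M => nth ord0 (enum (cover F)) i].
apply/imsetP; exists (phi, [set phi @^-1: (e : {set _}) | e in F]); first by rewrite inE.
rewrite /img /= -imset_comp -[LHS]imset_id; apply: eq_in_imset => e eF /=.
apply/setP => x; apply/idP/imsetP => [xe|[i]]; last by rewrite inE => ie ->.
have xF : x \in enum (cover F) by rewrite mem_enum; apply/bigcupP; exists e.
have lt : index x (enum (cover F)) < M.
  by apply: leq_trans FM; rewrite cardE index_mem.
by exists (Ordinal lt); rewrite ?inE ffunE /= nth_index.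
Qed.

Lemma ffact_ge m d : (m - d) ^ d <= m ^_ d.
Proof.
elim: d m => [|d IH] m; first by rewrite ffactn0.
case: m => [|m]; first by rewrite sub0n exp0n.
rewrite ffactSS subSS expnS; apply: leq_mul (IH m).
by rewrite (leq_trans (leq_subr _ _)).
Qed.

(** Each of the [d] factors of the falling factorial is at least [n / 2]. *)
Lemma bin_ge n t d : 2 * (d + t) <= n -> n ^ d <= 'C(n - t, d) * (d`! * 2 ^ d).
Proof.
move=> le; rewrite mulnA bin_ffact.
apply: (@leq_trans ((n - t - d) ^ d * 2 ^ d)); last by rewrite leq_mul2r ffact_ge orbT.
have [->|d0] := posnP d; first by rewrite !expn0.
by rewrite -expnMn leq_exp2r //; lia.
Qed.

Lemma four_edge_bound d t : 4 * (d + t) - 3 * t = 4 * d + t.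
Proof. lia. Qed.

Lemma ltn_add_pred a b t : 1 < t -> (a < b + t) = (a <= b + t.-1).
Proof. by case: t => // t _; rewrite addnS ltnS. Qed.

Lemma bes_number_le n t d : 1 < t -> 0 < d -> 3 < d + t ->
  bes_number (d + t) n (4 * (d + t) - 3 * t) 4 * 'C(d + t, t) <=
  'C(n, t) + 3 * 'C(n, t.-1) * 'C(d + t, t).
Proof.
move=> t2 d0 dt; have C0 : 0 < 'C(d + t, t) by rewrite bin_gt0 leq_addl.
rewrite -leq_divRL //; apply/bigmax_leqP => E /andP[/forall_inP Er nE].
have := @four_free_card _ _ _ t2 d0 E; rewrite card_ord leq_divRL // => le.
apply: le dt => [e /Er/eqP|F FE F4] //.
apply: contra nE => sF; apply/existsP; exists F; rewrite FE F4 eqxx /=.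
by apply: leq_trans sF _; rewrite F4 four_edge_bound.
Qed.

(** Both sides count pairs of a [t]-set inside a [(d + t)]-set; the proof cancels factorials. This
    evaluates the total initial weight of the nibble. *)
Lemma bin_split n t d : t + d <= n ->
  'C(n, d + t) * 'C(d + t, t) = 'C(n, t) * 'C(n - t, d).
Proof.
move=> le; apply/eqP; rewrite -(eqn_pmul2r (_ : 0 < t`! * d`! * (n - t - d)`!)); last first.
  by rewrite !muln_gt0 !fact_gt0.
have e1 := bin_fact (leq_addl d t); have e2 := bin_fact (_ : d + t <= n).
have e3 := bin_fact (_ : t <= n); have e4 := bin_fact (_ : d <= n - t).
rewrite addnK in e1; rewrite -subnDA addnC in e4.
have := e2 (etrans (congr1 (leq^~ n) (addnC d t)) le).
have := e3 (leq_trans (leq_addr d t) le).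
have := e4 _.
rewrite leq_subRL ?(leq_trans (leq_addr d t) le) // le => /(_ isT) f4 f3 f2.
apply/eqP; transitivity (n`!).
  by rewrite -f2 -e1 -subnDA [t + d]addnC; ring.
by rewrite -f3 -f4 -subnDA [t + d]addnC; ring.
Qed.

Local Open Scope ring_scope.

(** * Random subsets with independent elements *)

Section Subsets.
Variables (R : realFieldType) (E : finType).
Implicit Types (p : E -> R) (A B W : {set E}).

Definition subset_prob p W : R := \prod_f (if f \in W then p f else 1 - p f).

Definition expect p (g : {set E} -> R) : R := \sum_W subset_prob p W * g W.

Definition avoid_prob p A : R := \prod_(f in A) (1 - p f).

Definition is_prob p := forall f, 0 <= p f <= 1.

Lemma subset_prob_ge0 p W : is_prob p -> 0 <= subset_prob p W.
Proof.
move=> hp; apply: prodr_ge0 => f _; have /andP[h0 h1] := hp f.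
by case: ifP => _ //; rewrite subr_ge0.
Qed.

Lemma expect_prod p (a b : E -> R) :
  expect p (fun W => \prod_f (if f \in W then a f else b f)) =
  \prod_f (p f * a f + (1 - p f) * b f).
Proof.
rewrite bigA_distr; apply: eq_bigr => W _.
by rewrite -big_split; apply: eq_bigr => f _ /=; case: ifP.
Qed.

Lemma expect_cst p a : expect p (fun=> a) = a.
Proof.
rewrite /expect -mulr_suml.
have := expect_prod p (fun=> 1) (fun=> 1).
rewrite [RHS]big1 => [|f _]; last by ring.
rewrite /expect; under eq_bigr => W _.
  by rewrite big1 ?mulr1 => [|f _]; [over|case: ifP].
by move=> ->; rewrite mul1r.
Qed.

Lemma expectD p g1 g2 :
  expect p (fun W => g1 W + g2 W) = expect p g1 + expect p g2.
Proof. by rewrite /expect -big_split; apply: eq_bigr => W _; rewrite mulrDr. Qed.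

Lemma expectZ p a g : expect p (fun W => a * g W) = a * expect p g.
Proof. by rewrite /expect mulr_sumr; apply: eq_bigr => W _; rewrite mulrCA. Qed.

Lemma expectB p g1 g2 :
  expect p (fun W => g1 W - g2 W) = expect p g1 - expect p g2.
Proof. by rewrite /expect -sumrB; apply: eq_bigr => W _; rewrite mulrBr. Qed.

Lemma expect_sum p (I : finType) (P : pred I) (g : I -> {set E} -> R) :
  expect p (fun W => \sum_(i | P i) g i W) = \sum_(i | P i) expect p (g i).
Proof.
rewrite /expect exchange_big; apply: eq_bigr => W _; exact: mulr_sumr.
Qed.

Lemma eq_expect p g1 g2 : g1 =1 g2 -> expect p g1 = expect p g2.
Proof. by move=> eg; apply: eq_bigr => W _; rewrite eg. Qed.

Lemma ler_expect p g1 g2 : is_prob p -> (forall W, g1 W <= g2 W) ->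
  expect p g1 <= expect p g2.
Proof.
move=> hp le12; apply: ler_sum => W _.
by apply: ler_wpM2l => //; apply: subset_prob_ge0.
Qed.

(** First moment method: if every outcome were below [a], the nonnegative terms
    [subset_prob p W * (a - g W)] would sum to at most 0, and all probabilities would vanish. *)
Lemma expect_attained p g a : is_prob p -> a <= expect p g ->
  exists W, a <= g W.
Proof.
move=> hp le_a.
have [W hW|none] := pickP (fun W => a <= g W); first by exists W.
have lt_ga W : g W < a by rewrite ltNge none.
have ge0 W := subset_prob_ge0 W hp.
have /eqP eq0 : \sum_W subset_prob p W * (a - g W) == 0.
  rewrite eq_le; apply/andP; split; last first.
    by apply: sumr_ge0 => W _; apply: mulr_ge0 => //; rewrite subr_ge0 ltW.
  have -> : \sum_W subset_prob p W * (a - g W) = a - expect p g.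
    by rewrite -[in RHS](expect_cst p a) -expectB.
  by rewrite subr_le0.
suff : (1 : R) = 0 by move/eqP; rewrite oner_eq0.
rewrite -(expect_cst p 1) /expect big1 // => W _.
have /eqP := eq0; rewrite psumr_eq0; last first.
  by move=> V _; apply: mulr_ge0 => //; rewrite subr_ge0 ltW.
move/allP/(_ W (mem_index_enum _)) => /=; rewrite mulf_eq0 subr_eq0.
by rewrite [a == _]gt_eqF ?orbF // => /eqP ->; rewrite mul0r.
Qed.

Lemma prod_setind (A : {set E}) (G : E -> R) :
  \prod_(f in A) G f = \prod_f (if f \in A then G f else 1).
Proof. by rewrite big_mkcond. Qed.

Lemma expect_cylinder p A B : [disjoint A & B] ->
  expect p (fun W => ((A \subset W) && [disjoint B & W])%:R) =
  (\prod_(f in A) p f) * avoid_prob p B.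
Proof.
move=> dAB.
transitivity (expect p (fun W => \prod_f
   (if f \in W then (f \notin B)%:R else (f \notin A)%:R))).
  apply: eq_expect => W; case: (boolP (_ && _)) => [/andP[sAW dBW]|].
    rewrite big1 // => f _; case: ifP => fW.
      by case: (boolP (f \in B)) => // fB; rewrite (disjointFr dBW fB) in fW.
    by case: (boolP (f \in A)) => // fA; rewrite (subsetP sAW) in fW.
  rewrite negb_and => /orP[/subsetPn[f fA fW]|].
    by rewrite (bigD1 f) //= (negbTE fW) fA mul0r.
  rewrite -setI_eq0 => /set0Pn[f /setIP[fB fW]].
  by rewrite (bigD1 f) //= fW fB mul0r.
rewrite expect_prod /avoid_prob !prod_setind -big_split; apply: eq_bigr => f _ /=.
case: (boolP (f \in A)) => fA; first by rewrite (disjointFr dAB fA) /=; ring.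
by case: (boolP (f \in B)) => fB /=; ring.
Qed.

Lemma expect_cylinder_le p A B : is_prob p ->
  expect p (fun W => ((A \subset W) && [disjoint B & W])%:R) <=
  (\prod_(f in A) p f) * avoid_prob p B.
Proof.
move=> hp; have [dAB|] := boolP [disjoint A & B].
  by rewrite expect_cylinder.
rewrite -setI_eq0 => /set0Pn[f /setIP[fA fB]].
rewrite (@eq_expect p _ (fun=> 0)) ?expect_cst => [|W].
  apply: mulr_ge0; apply: prodr_ge0 => g _; have /andP[h0 h1] := hp g => //.
  by rewrite subr_ge0.
case: (boolP (_ && _)) => // /andP[sAW dBW].
by move: (subsetP sAW f fA); rewrite (disjointFr dBW fB).
Qed.

Lemma expect_subset p A :
  expect p (fun W => (A \subset W)%:R) = \prod_(f in A) p f.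
Proof.
have d0 W : [disjoint (set0 : {set E}) & W] by rewrite -setI_eq0 set0I.
have := @expect_cylinder p A set0; rewrite disjoint_sym /avoid_prob big_set0 mulr1.
by move=> <- //; apply: eq_expect => W; rewrite d0 andbT.
Qed.

Lemma expect_avoid p B :
  expect p (fun W => [disjoint B & W]%:R) = avoid_prob p B.
Proof.
have := @expect_cylinder p set0 B; rewrite -setI_eq0 set0I eqxx big_set0 mul1r.
by move=> <- //; apply: eq_expect => W; rewrite sub0set.
Qed.

Section Avoid.
Variables (p : E -> R) (hp : is_prob p).

Lemma avoid_prob_ge0 A : 0 <= avoid_prob p A.
Proof. by apply: prodr_ge0 => f _; have /andP[_ ?] := hp f; rewrite subr_ge0. Qed.

Lemma avoid_prob_le1 A : avoid_prob p A <= 1.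
Proof.
apply: prodr_ile1 => f _; have /andP[h0 h1] := hp f.
by rewrite subr_ge0 h1 lerBlDr lerDl.
Qed.

Lemma avoid_probU A B :
  avoid_prob p A * avoid_prob p B = avoid_prob p (A :|: B) * avoid_prob p (A :&: B).
Proof.
rewrite /avoid_prob !prod_setind -!big_split /=; apply: eq_bigr => f _.
by rewrite in_setU in_setI; case: (f \in A); case: (f \in B); rewrite /= ?mul1r ?mulr1.
Qed.

Lemma avoid_prob_ge A : 1 - \sum_(f in A) p f <= avoid_prob p A.
Proof.
suff [] : 0 <= \sum_(f in A) p f /\ 1 - \sum_(f in A) p f <= avoid_prob p A by [].
rewrite /avoid_prob; elim/big_rec2: _ => [|f S q _ [S0 IH]].
  by rewrite subr0 !lexx.
have /andP[h0 h1] := hp f.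
split; first exact: addr_ge0.
have := mulr_ge0 h0 S0.
have : 0 <= (1 - p f) * (q - (1 - S)) by apply: mulr_ge0; rewrite subr_ge0.
nra.
Qed.

(** Two avoidance events are nearly independent: by [avoid_probU] they differ from independence only
    by the factor for [A :&: B], which the union bound keeps near 1. *)
Lemma avoid_probU_le A B : avoid_prob p (A :|: B) <=
  avoid_prob p A * avoid_prob p B + \sum_(f in A :&: B) p f.
Proof.
rewrite avoid_probU; have h := avoid_prob_ge (A :&: B).
have h0 := avoid_prob_ge0 (A :|: B); have h1 := avoid_prob_le1 (A :|: B).
have S0 : 0 <= \sum_(f in A :&: B) p f by apply: sumr_ge0 => f _; have /andP[] := hp f.
have := mulr_ge0 h0 (_ : 0 <= avoid_prob p (A :&: B) - (1 - \sum_(f in A :&: B) p f)).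
have := mulr_ge0 S0 (_ : 0 <= 1 - avoid_prob p (A :|: B)).
rewrite !subr_ge0 => /(_ h1) h2 /(_ h) h3; nra.
Qed.

End Avoid.
End Subsets.

(** * A weighted nibble avoiding conflicts *)

Lemma prodrD_subsets (R : realFieldType) (E : finType) (F : {set E}) (a b : E -> R) :
  \prod_(f in F) (a f + b f) =
  \sum_(A in powerset F) (\prod_(f in A) a f) * \prod_(f in F :\: A) b f.
Proof.
transitivity (\prod_f ((if f \in F then a f else 0) + (if f \in F then b f else 1))).
  by rewrite prod_setind; apply: eq_bigr => f _; case: ifP => // _; rewrite add0r.
rewrite bigA_distr [RHS]big_mkcond; apply: eq_bigr => A _.
rewrite powersetE; case: (boolP (A \subset F)) => [/subsetP sAF|/subsetPn[f fA fF]].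
  rewrite !prod_setind -big_split; apply: eq_bigr => f _ /=.
  rewrite in_setD; case: (boolP (f \in A)) => fA /=; first by rewrite sAF ?mulr1.
  by rewrite mul1r.
by rewrite (bigD1 f) //= fA (negbTE fF) mul0r.
Qed.

(** Applies [avoid_probU_le] once for each [f]; the errors add up over pairs of overlapping sets
    [H f] and [H f']. *)
Lemma avoid_prob_bigcup_le (R : realFieldType) (E : finType) (p : E -> R)
    (H : E -> {set E}) (F : {set E}) : is_prob p ->
  avoid_prob p (\bigcup_(f in F) H f) <= \prod_(f in F) avoid_prob p (H f) +
    \sum_(f in F) \sum_(f' in F | f' != f) \sum_(g in H f :&: H f') p g.
Proof.
move=> hp; have p0 g : 0 <= p g by have /andP[] := hp g.
elim: {F}_.+1 {-2}F (ltnSn #|F|) => // n IH F leFn.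
have [->|/set0Pn[f fF]] := eqVneq F set0.
  by rewrite !big_set0 /avoid_prob big_set0 addr0.
rewrite (big_setD1 f fF) /= [X in _ <= X + _](big_setD1 f fF) /=.
rewrite [X in _ <= _ + X](big_setD1 f fF) /=.
apply: le_trans (avoid_probU_le hp _ _) _.
have cardF' : (#|F :\ f| < n)%N by move: leFn; rewrite (cardsD1 f F) fF.
have := ler_wpM2l (avoid_prob_ge0 hp (H f)) (IH _ cardF').
set S0 := \sum_(_ in _ :\ _) _; rewrite mulrDr => le1.
have S00 : 0 <= S0.
  by apply: sumr_ge0 => g _; apply: sumr_ge0 => k _; apply: sumr_ge0.
have le2 : avoid_prob p (H f) * S0 <= S0.
  by rewrite ler_piMl // avoid_prob_le1.
have le3 : S0 <= \sum_(g in F :\ f) \sum_(k in F | k != g) \sum_(i in H g :&: H k) p i.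
  apply: ler_sum => g _; rewrite [leRHS](bigID (mem [set f])) /=.
  rewrite -[leLHS]add0r; apply: lerD.
    by apply: sumr_ge0 => k _; apply: sumr_ge0.
  rewrite le_eqVlt; apply/orP; left; apply/eqP; apply: eq_bigl => k.
  by rewrite !inE; case: (k == f); case: (k \in F); case: (k == g).
have le4 : \sum_(i in H f :&: \bigcup_(g in F :\ f) H g) p i <=
    \sum_(g in F | g != f) \sum_(i in H f :&: H g) p i.
  rewrite [leRHS](eq_bigl (fun g => g \in F :\ f)); last first.
    by move=> g; rewrite !inE andbC.
  rewrite [leRHS](exchange_big_dep (fun i => i \in H f :&: \bigcup_(g in F :\ f) H g)) /=.
    apply: ler_sum => i; rewrite inE => /andP[iH /bigcupP[g gF iHg]].
    rewrite (bigD1 g) /=; last by rewrite gF inE iH iHg.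
    by rewrite lerDl sumr_ge0.
  move=> g i gF; rewrite !inE => /andP[-> iHg] /=.
  by apply/bigcupP; exists g.
move: le1 le2 le3 le4; set q := avoid_prob _ _ * _; lra.
Qed.

Lemma prod_setU_ge (R : realFieldType) (E : finType) (A B : {set E}) (G : E -> R) :
  (forall f, 0 <= G f <= 1) ->
  (\prod_(f in A) G f) * \prod_(f in B) G f <= \prod_(f in A :|: B) G f.
Proof.
move=> G01; rewrite !(prod_setind _ G) -big_split; apply: ler_prod => f _ /=.
have /andP[G0 G1] := G01 f; rewrite inE.
by case: (f \in A); case: (f \in B); rewrite /= ?mul1r ?mulr1 ?lexx ?ler01 ?G0 //
  mulr_ge0 // ler_piMl.
Qed.

(* [conf] consists of the forbidden families and [bad] of rare denser ones: by
   [bad_join] and [bad_cycle], the fates of two edges that both contain the vertex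
   [u], or both belong to a conflict [K], are correlated only through [bad]. *)
Section Nibble.
Variables (R : realFieldType) (E V : finType) (inc : V -> {set E}) (s : nat).
Variables (conf bad : {set {set E}}).
Hypothesis inc_card : forall f, (#|[set u | f \in inc u]| <= s)%N.
Hypothesis conf_card : forall K, K \in conf -> (2 <= #|K| <= 4)%N.
Hypothesis conf_pair : forall K, K \in conf -> #|K| = 2 ->
  exists u, K \subset inc u.
Hypothesis bad_card : forall F, F \in bad -> (#|F| <= 10)%N.
Hypothesis bad_join : forall u f f' g K K', f \in inc u -> f' \in inc u ->
  f != f' -> g \notin inc u -> K \in conf -> K' \in conf ->
  f \in K -> g \in K -> f' \in K' -> g \in K' -> K :|: K' \in bad.
Hypothesis bad_cycle : forall f f' g K K1 K2, K \in conf -> K1 \in conf ->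
  K2 \in conf -> (2 < #|K|)%N -> f \in K -> f' \in K -> f != f' -> g != f ->
  g != f' -> f \in K1 -> g \in K1 -> f' \in K2 -> g \in K2 -> f' \notin K1 ->
  f \notin K2 -> K :|: K1 :|: K2 \in bad.

Implicit Types (U W K F : {set E}) (w : E -> R) (f g : E).

Definition conf_free U := [forall K in conf, ~~ (K \subset U)].

Definition mix U w f : R := if f \in U then 1 else w f.

Definition mono U w F : R := \prod_(f in F) mix U w f.

(** Conflicts of two edges are left out: by [conf_pair] they lie inside some [inc u] and are
    controlled by [st_deg]. *)
Definition conf_weight U w := \sum_(K in conf | (2 < #|K|)%N) mono U w K.

Definition bad_weight U w := \sum_(F in bad) mono U w F.

(** The partial derivative of [conf_weight] in the coordinate [f]. *)
Definition conf_at U w f :=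
  \sum_(K in conf | (f \in K) && (2 < #|K|)%N) mono U w (K :\ f).

Record state U w (mu : R) := State {
  st_ge0 : forall f, 0 <= w f;
  st_max : forall f, w f <= mu;
  st_out : forall f, f \in U -> w f = 0;
  st_free : conf_free U;
  st_ext : forall f, w f != 0 -> conf_free (f |: U);
  st_deg : forall u, \sum_(f in inc u) w f <= 1 }.

Lemma mono_ge0 U w F : (forall f, 0 <= w f) -> 0 <= mono U w F.
Proof. by move=> w0; apply: prodr_ge0 => f _; rewrite /mix; case: ifP. Qed.

Lemma mono_setD U w F : mono U w F = \prod_(f in F :\: U) w f.
Proof.
rewrite /mono [RHS]big_mkcond [LHS]big_mkcond; apply: eq_bigr => f _.
by rewrite inE /mix; case: (f \in U) => //=; case: ifP.
Qed.

Lemma ler_mono U w w' F : (forall f, 0 <= w f) -> (forall f, w f <= w' f) ->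
  mono U w F <= mono U w' F.
Proof.
move=> w0 le; apply: ler_prod => f _; rewrite /mix; case: ifP => _.
  by rewrite ler01 lexx.
by rewrite w0 le.
Qed.

Lemma conf_weight_ge0 U w : (forall f, 0 <= w f) -> 0 <= conf_weight U w.
Proof. by move=> w0; apply: sumr_ge0 => K _; apply: mono_ge0. Qed.

Lemma bad_weight_ge0 U w : (forall f, 0 <= w f) -> 0 <= bad_weight U w.
Proof. by move=> w0; apply: sumr_ge0 => K _; apply: mono_ge0. Qed.

Lemma ler_conf_weight U w w' : (forall f, 0 <= w f) -> (forall f, w f <= w' f) ->
  conf_weight U w <= conf_weight U w'.
Proof. by move=> w0 le; apply: ler_sum => K _; apply: ler_mono. Qed.

Lemma ler_bad_weight U w w' : (forall f, 0 <= w f) -> (forall f, w f <= w' f) ->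
  bad_weight U w <= bad_weight U w'.
Proof. by move=> w0 le; apply: ler_sum => K _; apply: ler_mono. Qed.

(** Charging: each index is paid for by a bad family related to it by [Q], and a family pays for at
    most [M] indices. *)
Lemma sum_le_bad_weight U w (I : finType) (P : pred I) (val : I -> R)
    (Q : {set E} -> pred I) (M : nat) : (forall f, 0 <= w f) ->
  (forall i, P i -> exists2 F, F \in bad & Q F i && (val i <= mono U w F)) ->
  (forall F, F \in bad -> (#|[set i | Q F i]| <= M)%N) ->
  \sum_(i | P i) val i <= M%:R * bad_weight U w.
Proof.
move=> w0 ex cardQ.
apply: (@le_trans _ _ (\sum_(i | P i) \sum_(F in bad | Q F i) mono U w F)).
  apply: ler_sum => i /ex[F Fbad /andP[QF le]].
  rewrite (bigD1 F) /=; last by rewrite Fbad.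
  by apply: le_trans le _; rewrite lerDl sumr_ge0 // => *; apply: mono_ge0.
rewrite (exchange_big_dep (mem bad)) /=; last by move=> i F _ /andP[].
rewrite /bad_weight mulr_sumr; apply: ler_sum => F Fbad.
rewrite sumr_const -[leLHS]mulr_natl ler_wpM2r ?mono_ge0 // ler_nat.
apply: leq_trans (cardQ _ Fbad); apply: subset_leq_card; apply/subsetP => i.
by rewrite !inE => /andP[_ /andP[]].
Qed.

(** * One round of the nibble *)

Section Step.
Variables (U : {set E}) (w : E -> R) (mu lam del eta : R).
Hypothesis Sw : state U w mu.
Hypothesis mu0 : 0 <= mu.
Hypothesis mu1 : mu <= 1.
Hypothesis conf_at_le : forall f, w f != 0 -> conf_at U w f <= lam.
Let h := s%:R + lam.
Hypothesis del0 : 0 < del.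
Hypothesis del_h : del * h <= 1 / 2%:R.
Hypothesis del1 : del <= 1 / 2%:R.
Hypothesis eta01 : 0 < eta <= 1.

Let w0 f : 0 <= w f. Proof. exact: (st_ge0 Sw). Qed.
Let w01 f : 0 <= w f <= 1.
Proof. by rewrite w0 (le_trans (st_max Sw f)). Qed.

Let del_ge0 : 0 <= del. Proof. exact: ltW. Qed.
Let del_le1 : del <= 1. Proof. by move: del1 => ?; lra. Qed.

Let p f := del * w f.

Let p_prob : is_prob p.
Proof.
by move=> f; have /andP[wf0 wf1] := w01 f; rewrite /p mulr_ge0 //= mulr_ile1.
Qed.

Let p0 f : 0 <= p f. Proof. by have /andP[] := p_prob f. Qed.

Let p_le f : p f <= w f.
Proof. by rewrite /p ler_piMl. Qed.

Let confS : conf_free U. Proof. exact: st_free Sw. Qed.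

Let extP f K : w f != 0 -> K \in conf -> f \in K ->
  exists2 g, g \in K :\ f & g \notin U.
Proof.
move=> wf Kc fK; have := st_ext Sw wf.
move=> /forallP/(_ K); rewrite Kc /= => /subsetPn[g gK].
rewrite !inE negb_or => /andP[gf gS]; exists g => //.
by rewrite !inE gf.
Qed.

Lemma prod_scaled n (A : {set E}) : (n <= #|A|)%N ->
  \prod_(g in A) p g <= del ^+ n * \prod_(g in A) w g.
Proof.
move=> leA; rewrite /p big_split /= prodr_const.
apply: ler_wpM2r; first by apply: prodr_ge0 => f _; apply: w0.
by apply: ler_wiXn2l.
Qed.

Lemma mono_conf_scaled f K : w f != 0 -> K \in conf -> f \in K ->
  \prod_(g in (K :\ f) :\: U) p g <= del * mono U w (K :\ f).
Proof.
move=> wf Kc fK; have [g gK gU] := extP wf Kc fK.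
rewrite mono_setD -[X in X * _]expr1; apply: prod_scaled.
by rewrite card_gt0; apply/set0Pn; exists g; rewrite in_setD gU.
Qed.

(** Partners of [f] in two-edge conflicts lie over one of the at most [s] vertices of [f], each of
    total weight at most 1; larger conflicts make up [conf_at]. *)
Lemma conf_sum_le f : w f != 0 ->
  \sum_(K in conf | f \in K) mono U w (K :\ f) <= h.
Proof.
move=> wf; rewrite (bigID (fun K : {set E} => #|K| == 2)) /= /h; apply: lerD; last first.
  apply: le_trans (conf_at_le wf); rewrite /conf_at.
  rewrite le_eqVlt; apply/orP; left; apply/eqP; apply: eq_bigl => K.
  case: (boolP (K \in conf)) => //= Kc; have /andP[K2 _] := conf_card Kc.
  by case: (f \in K) => //=; rewrite ltn_neqAle K2 eq_sym andbT.
apply: (@le_trans _ _ (\sum_(u | f \in inc u) \sum_(g in inc u) w g)); last first.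
  apply: (@le_trans _ _ (\sum_(u | f \in inc u) 1)).
    by apply: ler_sum => u _; apply: (st_deg Sw).
  by rewrite sumr_const ler_nat -cardsE inc_card.
have K2P K : (K \in conf) && (f \in K) && (#|K| == 2) ->
    exists g, [/\ K = [set f; g], g != f, mono U w (K :\ f) = w g &
      exists2 u, f \in inc u & g \in inc u].
  move=> /andP[/andP[Kc fK] /eqP K2].
  have [u /subsetP Ku] := conf_pair Kc K2.
  have /cards1P[g Kfg] : #|K :\ f| == 1 by move: K2; rewrite (cardsD1 f) fK add1n => -[->].
  have gK : g \in K :\ f by rewrite Kfg inE.
  have [gf gK'] : g != f /\ g \in K by apply/andP; rewrite -in_setD1.
  exists g; split=> //.
  - by rewrite -(setD1K fK) Kfg.
  - have [k] := extP wf Kc fK; rewrite Kfg inE => /eqP -> gS.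
    by rewrite /mono big_set1 /mix (negbTE gS).
  - by exists u; apply: Ku.
rewrite (exchange_big_dep predT) //=.
(* Sorts the pairs by the partner of [f]; [K :\ f] is nonempty, so the default [f] is never
   taken. *)
rewrite (partition_big (fun K => odflt f [pick g in K :\ f]) predT) //=.
apply: ler_sum => g _.
have [gu|nu] := boolP [exists u, (f \in inc u) && (g \in inc u)]; last first.
  rewrite big1 ?sumr_ge0 // => K /andP[/K2P[k [-> kf _ [u fu ku]]]] /eqP.
  case: pickP => [l|/(_ k)]; last by rewrite !inE kf eqxx orbT.
  rewrite !inE => /andP[/negbTE -> /= /eqP ->] /= kg.
  by case/existsP: nu; exists u; rewrite fu -kg ku.
have /existsP[u /andP[fu gu']] := gu.
rewrite (bigD1 u) /=; last by rewrite fu gu'.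
apply: (@le_trans _ _ (w g)); last by rewrite lerDl sumr_ge0.
have pickE K k : K = [set f; k] -> k != f -> odflt f [pick g in K :\ f] = k.
  move=> -> kf; case: pickP => [l|/(_ k)]; last by rewrite !inE kf eqxx orbT.
  by rewrite !inE => /andP[/negbTE -> /= /eqP ->].
rewrite (eq_bigr (fun=> w g)) => [|K /andP[/K2P[k [eK kf -> _]]]]; last first.
  by rewrite (pickE K k) // => /eqP ->.
rewrite big_mkcond /= (bigD1 [set f; g]) //= big1 ?addr0 => [|K neK].
  by case: ifP.
case: ifP => // /andP[/K2P[k [eK kf _ _]]]; rewrite (pickE K k) // => /eqP kg.
by rewrite eK kg eqxx in neK.
Qed.

(** The edges whose selection alone kills [f], the rest of some conflict being already chosen. *)
Definition threat f := [set g | [&& g \notin U, g != f &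
  [exists K in conf, [&& f \in K, g \in K & (K :\ f) :\ g \subset U]]]].

Let H := threat.

Lemma threatP f g : reflect (exists K, [/\ g \notin U, g != f, K \in conf &
  [/\ f \in K, g \in K & (K :\ f) :\ g \subset U]]) (g \in H f).
Proof.
rewrite inE; apply: (iffP and3P) => [[gS gf /existsP[K /and4P[]]]|[K []]].
  by exists K.
move=> gS gf Kc [fK gK sK]; split=> //.
by apply/existsP; exists K; rewrite Kc fK gK.
Qed.

(** A threat [g] appears in [conf_sum_le] through a conflict whose part outside [U], apart from [f],
    is [g] alone; the conflict determines this [g]. *)
Lemma threat_sum_le f : w f != 0 -> \sum_(g in H f) w g <= h.
Proof.
move=> wf; apply: le_trans (conf_sum_le wf).
pose P g K := [&& K \in conf, f \in K & ((K :\ f) :\: U == [set g])].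
apply: (@le_trans _ _ (\sum_(g in H f) \sum_(K | P g K) mono U w (K :\ f))).
  apply: ler_sum => g /threatP[K [gS gf Kc [fK gK sK]]].
  have PK : P g K.
    rewrite /P Kc fK; apply/eqP/setP => k; rewrite !inE.
    have [->|kg] := eqVneq k g; first by rewrite gS gf gK.
    have := subsetP sK k; rewrite !inE kg.
    by case: (k \in U) => //=; case: (_ && _) => // /(_ isT).
  rewrite (bigD1 K) //= mono_setD; move: (PK) => /and3P[_ _ /eqP ->].
  by rewrite big_set1 lerDl sumr_ge0 // => *; apply: mono_ge0.
rewrite (exchange_big_dep (fun K => (K \in conf) && (f \in K))) /=; last first.
  by move=> g K _ /and3P[-> ->].
apply: ler_sum => K /andP[Kc fK].
have [[g Pg]|none] := altP (@existsP _ (fun g => (g \in H f) && P g K)); last first.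
  rewrite big_pred0 ?mono_ge0 // => g; apply: contraNF none => Pg.
  by apply/existsP; exists g.
rewrite (big_pred1 g) // => k /=; apply/idP/eqP => [|-> //].
move: Pg => /andP[_ /and3P[_ _ /eqP eg]] /andP[_ /and3P[_ _ /eqP]].
by rewrite eg => /eqP; rewrite eqEcard sub1set inE => /andP[/eqP].
Qed.

Let q := avoid_prob p.

Let q_ge f : w f != 0 -> 1 / 2%:R <= q (H f).
Proof.
move=> wf; apply: le_trans (avoid_prob_ge p_prob (H f)).
have : \sum_(g in H f) p g <= del * h.
  by rewrite -mulr_sumr ler_wpM2l ?threat_sum_le.
by move: del_h; lra.
Qed.

Let q_ge0 A : 0 <= q A. Proof. exact: avoid_prob_ge0. Qed.
Let q_le1 A : q A <= 1. Proof. exact: avoid_prob_le1. Qed.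

Let q_gt0 f : w f != 0 -> 0 < q (H f).
Proof. by move=> /q_ge; apply: lt_le_trans; rewrite divr_gt0. Qed.

(* An edge [f] outside the random set has no threat in it with probability
   [avoid_prob p (H f)]; dividing by it gives all edges the same expected loss. *)
Definition boost f := (1 - del) * w f / avoid_prob p (H f).

Let a := boost.

Let a_q f : a f * q (H f) = (1 - del) * w f.
Proof.
rewrite /a /boost; have [->|wf] := eqVneq (w f) 0; first by rewrite mulr0 !mul0r.
by rewrite divfK // gt_eqF // q_gt0.
Qed.

Let a_ge0 f : 0 <= a f.
Proof. by rewrite /a /boost !mulr_ge0 ?invr_ge0 ?q_ge0 // subr_ge0. Qed.

Let a_le f : a f <= 2%:R * w f.
Proof.
have [wf|wf] := eqVneq (w f) 0.
  by rewrite /a /boost wf mulr0 mul0r mulr0.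
have q0 := q_gt0 wf.
rewrite /a /boost ler_pdivrMr // -/q; have := q_ge wf; have := w0 f.
have := del0; nra.
Qed.

Definition blocked W f := [exists K in conf, (f \in K) && (K :\ f \subset U :|: W)].

(** Blocking refers to all of [W], not only to the edges that get added, so every new edge of a
    conflict inside [U :|: W] is rejected. *)
Definition next_set W := U :|: [set f in W | (w f != 0) && ~~ blocked W f].

Definition next_weight W f : R :=
  if [|| f \in U, f \in W | blocked W f] then 0 else a f.

Definition full W := [set u | 1 + eta < \sum_(f in inc u) next_weight W f].

(** Restores the degree bound, which [next_weight] meets only on average. *)
Definition next_weight_trim W f : R :=
  if [exists u in full W, f \in inc u] then 0 else next_weight W f / (1 + eta).

Lemma next_weight_ge0 W f : 0 <= next_weight W f.
Proof. by rewrite /next_weight; case: ifP. Qed.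

Lemma next_weight_le W f : next_weight W f <= 2%:R * w f.
Proof. by rewrite /next_weight; case: ifP => // _; rewrite mulr_ge0. Qed.

Let eta0 : 0 < eta. Proof. by have /andP[] := eta01. Qed.

Lemma trim_ge0 W f : 0 <= next_weight_trim W f.
Proof.
rewrite /next_weight_trim; case: ifP => // _.
by rewrite divr_ge0 ?next_weight_ge0 // addr_ge0 // ltW.
Qed.

Lemma trim_le W f : next_weight_trim W f <= next_weight W f.
Proof.
rewrite /next_weight_trim; case: ifP => _; first exact: next_weight_ge0.
rewrite ler_pdivrMr; last by rewrite addr_gt0.
by rewrite ler_peMr ?next_weight_ge0 // lerDl ltW.
Qed.

Lemma trim_neq0 W f : next_weight_trim W f != 0 ->
  [/\ f \notin U, f \notin W & ~~ blocked W f].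
Proof.
move=> nz; apply/and3P; rewrite -!negb_or; apply: contra nz => hf.
rewrite eq_le trim_ge0 andbT (le_trans (trim_le _ _)) //.
by rewrite /next_weight hf.
Qed.

Lemma next_conf_free W : conf_free (next_set W).
Proof.
apply/forallP => K; apply/implyP => Kc; apply/negP => /subsetP sK.
have [/existsP[f /andP[fK fW]]|none] := boolP [exists f, (f \in K) && (f \in [set f in W | (w f != 0) && ~~ blocked W f])].
  move: fW; rewrite inE => /and3P[_ _ /negP]; apply; apply/existsP; exists K.
  rewrite Kc fK /=; apply/subsetP => g; rewrite !inE => /andP[_ /sK].
  by rewrite !inE => /orP[->//|/andP[->]]; rewrite orbT.
have /negP := implyP (forallP confS K) Kc; apply; apply/subsetP => f fK.
have := sK f fK; rewrite in_setU => /orP[//|fW].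
by case/existsP: none; exists f; rewrite fK.
Qed.

Lemma next_ext W f : next_weight_trim W f != 0 -> conf_free (f |: next_set W).
Proof.
move=> /trim_neq0[fU fW /existsPn nb].
apply/forallP => K; apply/implyP => Kc; apply/negP => sK.
have [fK|fK] := boolP (f \in K).
  have := nb K; rewrite Kc fK /= => /negP; apply.
  apply/subsetP => g; rewrite in_setD1 => /andP[gf gK].
  have := subsetP sK g gK; rewrite !inE (negbTE gf) /= => /orP[->//|/andP[->]].
  by rewrite orbT.
have := next_conf_free W => /forallP/(_ K); rewrite Kc /= => /negP; apply.
apply/subsetP => g gK; have := subsetP sK g gK; rewrite in_setU1 => /orP[/eqP gf|//].
by rewrite -gf gK in fK.
Qed.

Lemma trim_deg W u : \sum_(f in inc u) next_weight_trim W f <= 1.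
Proof.
have e0 : 0 < 1 + eta by rewrite addr_gt0.
have [uF|uF] := boolP (u \in full W).
  rewrite big1 ?ler01 // => f fu; rewrite /next_weight_trim ifT //.
  by apply/existsP; exists u; rewrite uF.
apply: (@le_trans _ _ (\sum_(f in inc u) next_weight W f / (1 + eta))).
  apply: ler_sum => f fu; rewrite /next_weight_trim; case: ifP => // _.
  by rewrite divr_ge0 ?next_weight_ge0 // ltW.
by rewrite -mulr_suml ler_pdivrMr // mul1r leNgt; move: uF; rewrite inE.
Qed.

Lemma trim_state W : state (next_set W) (next_weight_trim W) (2%:R * mu).
Proof.
split.
- exact: trim_ge0.
- move=> f; apply: le_trans (trim_le _ _) _; apply: le_trans (next_weight_le _ _) _.
  by rewrite ler_wpM2l // (st_max Sw).
- move=> f; rewrite !inE => fS; apply/eqP; apply: contraLR fS => /trim_neq0[fU fW _].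
  by rewrite negb_or fU /= negb_and fW.
- exact: next_conf_free.
- exact: next_ext.
- exact: trim_deg.
Qed.

Lemma threat_blocked W f g : g \in H f -> g \in W -> blocked W f.
Proof.
move=> /threatP[K [_ _ Kc [fK gK sK]]] gW; apply/existsP; exists K.
rewrite Kc fK /=; apply/subsetP => k kK; rewrite in_setU.
have [->|kg] := eqVneq k g; first by rewrite gW orbT.
by rewrite (subsetP sK) // in_setD1 kg.
Qed.

Lemma blocked_disjoint W f : ~~ blocked W f -> [disjoint H f & W].
Proof.
move=> nb; rewrite -setI_eq0; apply: contraNT nb => /set0Pn[g /setIP[gH gW]].
exact: threat_blocked gH gW.
Qed.

Lemma subUW (A W : {set E}) : (A \subset U :|: W) = (A :\: U \subset W).
Proof. by rewrite subDset. Qed.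

Lemma blocked_le_sum W f : (blocked W f)%:R <=
  \sum_(K in conf | f \in K) ((K :\ f) :\: U \subset W)%:R :> R.
Proof.
case: (boolP (blocked W f)) => [/existsP[K /and3P[Kc fK sK]]|_]; last by rewrite sumr_ge0.
rewrite (bigD1 K) /=; last by rewrite Kc.
by rewrite -subUW sK lerDl sumr_ge0.
Qed.

Lemma natr_card (A : {set E}) : #|A|%:R = \sum_f (f \in A)%:R :> R.
Proof. by rewrite -sum1_card natr_sum big_mkcond; apply: eq_bigr => f _; case: ifP. Qed.

(** An edge [f] is selected with probability [p f]. In each conflict at [f] the remaining edges are
    independent of [f] and include one outside [U], so blocking costs at most a fraction
    [del * h]. *)
Lemma expect_next_card : #|U|%:R + del * (1 - del * h) * \sum_f w f <=
  expect p (fun W => #|next_set W|%:R).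
Proof.
apply: (@le_trans _ _ (expect p (fun W => #|U|%:R + \sum_(f | w f != 0)
   ((f \in W)%:R - \sum_(K in conf | f \in K) (f |: (K :\ f) :\: U \subset W)%:R)))).
  rewrite expectD expect_cst lerD2l expect_sum mulr_sumr.
  rewrite [leLHS](bigID (fun f => w f != 0)) /= [X in _ + X]big1 ?addr0; last first.
    by move=> f /negPn/eqP ->; rewrite mulr0.
  apply: ler_sum => f wf; rewrite expectB expect_sum.
  have -> : expect p (fun W => (f \in W)%:R) = p f.
    rewrite (@eq_expect _ _ _ _ (fun W => ([set f] \subset W)%:R)) => [|W].
      by rewrite expect_subset big_set1.
    by rewrite sub1set.
  have le1 : \sum_(K in conf | f \in K) expect p (fun W => (f |: (K :\ f) :\: U \subset W)%:R)
    <= p f * (del * h).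
    apply: (@le_trans _ _ (p f * (del * \sum_(K in conf | f \in K) mono U w (K :\ f)))).
      rewrite !mulr_sumr; apply: ler_sum => K /andP[Kc fK].
      rewrite expect_subset big_setU1 ?inE ?eqxx ?andbF //=.
      by rewrite ler_wpM2l // mono_conf_scaled.
    by rewrite ler_wpM2l // ler_wpM2l // conf_sum_le.
  by apply: le_trans (lerB (lexx (p f)) le1); rewrite /p; nra.
apply: ler_expect => // W.
rewrite /next_set (_ : U :|: _ = U :|: [set f in W | (w f != 0) && ~~ blocked W f] :\: U); last first.
  by apply/setP => f; rewrite !inE; case: (f \in U).
rewrite cardsU (_ : _ :&: _ = set0) ?cards0 ?subn0 ?natrD ?lerD2l; last first.
  by apply/setP => f; rewrite !inE; case: (f \in U).
rewrite [leRHS]natr_card [leRHS](bigID (fun f => w f != 0)) /= -[leLHS]addr0.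
apply: lerD; last exact: sumr_ge0.
apply: ler_sum => f wf; have fU : f \notin U by apply: contra wf => fU; rewrite (st_out Sw).
rewrite !inE fU wf /=.
case: (boolP (f \in W)) => fW; last first.
  by rewrite sub0r oppr_le0 sumr_ge0.
have := blocked_le_sum W f; rewrite (eq_bigr (fun K : {set E} => (f |: (K :\ f) :\: U \subset W)%:R)).
  by case: (blocked W f) => /=; lra.
by move=> K _; rewrite subUset sub1set fW.
Qed.

(** Avoiding [f] and its threats has probability [(1 - p f) * q (H f)], and [boost] cancels
    [q (H f)]. A conflict that blocks without a threat needs two further selected edges, whence the
    term with [del ^+ 2 * lam]. *)
Lemma expect_next_weight f :
  w f * (1 - del - mu - 2%:R * del ^+ 2 * lam) <= expect p (fun W => next_weight W f).
Proof.
have [wf|wf] := eqVneq (w f) 0.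
  rewrite wf mul0r -(expect_cst p 0); apply: ler_expect => // W.
  exact: next_weight_ge0.
have fU : f \notin U by apply: contra wf => fU; rewrite (st_out Sw).
pose P (K : {set E}) := [&& f \in K, (2 < #|K|)%N & (1 < #|(K :\ f) :\: U|)%N].
apply: (@le_trans _ _ (expect p (fun W => a f * ([disjoint f |: H f & W]%:R -
   \sum_(K in conf | P K) ((K :\ f) :\: U \subset W)%:R)))); last first.
  apply: ler_expect => // W; rewrite /next_weight (negbTE fU) /=.
  case: (boolP (f \in W)) => fW /=.
    rewrite mulr_ge0_le0 // subr_le0 (_ : [disjoint _ & _] = false) ?sumr_ge0 //.
    by apply/negbTE; rewrite -setI_eq0; apply/set0Pn; exists f; rewrite !inE eqxx.
  case: (boolP (blocked W f)) => [/existsP[K /and3P[Kc fK]]|_].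
    rewrite subUW => sK; rewrite mulr_ge0_le0 // subr_le0.
    case: (leqP #|(K :\ f) :\: U| 1) => [K1|K1]; last first.
      rewrite (bigD1 K) /=; last first.
        rewrite Kc /P fK K1 (leq_trans (_ : 2 < #|(K :\ f) :\: U|.+1)%N) //.
        rewrite (cardsD1 f K) fK add1n ltnS; apply: subset_leq_card.
        exact: subsetDl.
      rewrite sK; apply: (@le_trans _ _ 1); last by rewrite lerDl sumr_ge0.
      by case: [disjoint _ & _].
    have [g gK gU] := extP wf Kc fK.
    rewrite (_ : [disjoint _ & _] = false) ?sumr_ge0 //.
    apply/negbTE; rewrite -setI_eq0; apply/set0Pn; exists g.
    have gW : g \in W by apply: (subsetP sK); rewrite in_setD gU.
    rewrite in_setI gW andbT in_setU1; apply/orP; right; apply/threatP; exists K.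
    move: (gK); rewrite in_setD1 => /andP[gf gK']; split=> //; split=> //.
    apply/subsetP => k; rewrite in_setD1 => /andP[kg kK].
    apply: contraNT kg => kU; apply/eqP/(card_le1_eqP K1); by rewrite in_setD ?kU ?gU.
  rewrite ler_piMr // lerBlDr -[leLHS]addr0; apply: lerD; last exact: sumr_ge0.
  by case: [disjoint _ & _].
rewrite expectZ expectB expect_avoid expect_sum.
have -> : avoid_prob p (f |: H f) = (1 - p f) * q (H f).
  by rewrite /q /avoid_prob big_setU1 //=; apply/threatP => -[K []] _; rewrite eqxx.
have le1 : \sum_(K in conf | P K) expect p (fun W => ((K :\ f) :\: U \subset W)%:R) <=
    del ^+ 2 * lam.
  apply: le_trans (ler_wpM2l (exprn_ge0 2 del_ge0) (conf_at_le wf)).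
  rewrite /conf_at mulr_sumr [leRHS](bigID (fun K : {set E} => 1 < #|(K :\ f) :\: U|)%N) /=.
  rewrite -[leLHS]addr0; apply: lerD; last first.
    by apply: sumr_ge0 => K _; rewrite mulr_ge0 ?exprn_ge0 ?mono_ge0.
  rewrite (eq_bigl (fun K => (K \in conf) && [&& f \in K & (2 < #|K|)%N] && (1 < #|(K :\ f) :\: U|)%N)).
    by apply: ler_sum => K /andP[_ K2]; rewrite expect_subset mono_setD prod_scaled.
  by move=> K; rewrite /P -!andbA.
have : a f * \sum_(K in conf | P K) expect p (fun W => ((K :\ f) :\: U \subset W)%:R) <=
    2%:R * w f * (del ^+ 2 * lam).
  apply: ler_pM => //; apply: sumr_ge0 => K _; rewrite -(expect_cst p 0).
  exact: ler_expect.
rewrite [a f * (_ - _)]mulrBr.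
have -> : a f * ((1 - p f) * q (H f)) = (1 - p f) * ((1 - del) * w f).
  by rewrite -a_q; ring.
have := p_le f; have := st_max Sw f; have := w0 f.
have := p0 f; move: del_ge0 del_le1.
set X := \sum_(_ in _ | _) _ => d0 d1 pf0 wf0 wmu pw le2.
have : 0 <= w f * (mu - p f) by rewrite mulr_ge0 // subr_ge0 (le_trans pw).
have : 0 <= w f * p f * del by rewrite !mulr_ge0.
nra.
Qed.

(** Majorant for a coordinate after the round: of all ways to block [f] it keeps only the threats,
    so that products reduce to [expect_cylinder_le]. *)
Let major W f : R := (f \in W)%:R + [disjoint H f & W]%:R * a f.

Let major_ge0 W f : 0 <= major W f.
Proof. by rewrite addr_ge0 // mulr_ge0. Qed.

Let mono_next_le W F :
  mono (next_set W) (next_weight W) F <= \prod_(f in F :\: U) major W f.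
Proof.
rewrite /mono (prod_setind (F :\: U)) (prod_setind F); apply: ler_prod => f _.
rewrite in_setD; case: (f \in F); last by rewrite andbF ler01 lexx.
rewrite andbT /mix /next_weight /next_set !inE; case: (boolP (f \in U)) => fU /=.
  by rewrite ler01 lexx.
rewrite /major; case: (boolP (f \in W)) => fW /=.
  have : 0 <= [disjoint H f & W]%:R * a f by rewrite mulr_ge0.
  by case: (w f == 0); case: (blocked W f) => /=; lra.
case: (boolP (blocked W f)) => nb /=; first by rewrite lexx add0r mulr_ge0.
by rewrite a_ge0 blocked_disjoint // mul1r add0r lexx.
Qed.

(** Crude bound: the coordinate of [f] is at most [2 * w f], plus 1 if [f] is selected. These bounds
    are independent, each with expectation at most [3 * w f]. *)
Lemma expect_mono_le F : (#|F| <= 10)%N ->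
  expect p (fun W => mono (next_set W) (next_weight W) F) <=
  3%:R ^+ 10 * mono U w F.
Proof.
move=> F10.
apply: (@le_trans _ _ (expect p (fun W =>
    \prod_f (if f \in W then (if f \in F :\: U then 1 + 2%:R * w f else 1)
             else (if f \in F :\: U then 2%:R * w f else 1))))).
  apply: ler_expect => // W; apply: le_trans (mono_next_le W F) _.
  rewrite prod_setind; apply: ler_prod => f _.
  case: (f \in F :\: U); last by rewrite if_same ler01 lexx.
  rewrite major_ge0 /major; have := a_le f; have := a_ge0 f.
  by case: (f \in W); case: [disjoint H f & W] => /=; have := w0 f; lra.
rewrite expect_prod mono_setD.
apply: (@le_trans _ _ (\prod_(f in F :\: U) (3%:R * w f))).
  rewrite [leRHS]prod_setind; apply: ler_prod => f _.
  have := p_le f; have := w0 f; have := p0 f.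
  by case: ifP => _ *; apply/andP; split; lra.
rewrite big_split /= prodr_const; apply: ler_wpM2r.
  by apply: prodr_ge0 => f _; apply: w0.
rewrite ler_weXn2l ?ler1n //; apply: leq_trans F10; apply: subset_leq_card.
exact: subsetDl.
Qed.

Lemma expect_bad_weight :
  expect p (fun W => bad_weight (next_set W) (next_weight W)) <=
  3%:R ^+ 10 * bad_weight U w.
Proof.
rewrite expect_sum mulr_sumr; apply: ler_sum => F Fb.
by apply: expect_mono_le; apply: bad_card.
Qed.

Let overlap F := \sum_(f in F) \sum_(f' in F | f' != f) \sum_(g in H f :&: H f') w g.

Let overlap_ge0 F : 0 <= overlap F.
Proof. by do 3![apply: sumr_ge0 => ? _]. Qed.

Let overlap_sub F (G : {set E}) : F \subset G -> overlap F <= overlap G.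
Proof.
move=> sFG; rewrite /overlap [leRHS](big_setID F) /= (setIidPr sFG) -[leLHS]addr0.
apply: lerD; last by do 3![apply: sumr_ge0 => ? _].
apply: ler_sum => f fF; rewrite [leRHS](bigID (mem F)) /= -[leLHS]addr0.
apply: lerD; last by do 2![apply: sumr_ge0 => ? _].
rewrite le_eqVlt; apply/orP; left; apply/eqP; apply: eq_bigl => g.
by case: (boolP (g \in F)) => gF; rewrite ?andbF // (subsetP sFG) //= andbT.
Qed.

(** Expands over the set [A] of selected edges. If survivals were independent, the factors [p f] and
    [(1 - del) * w f] would add up to [w f], the martingale property; common threats cause the
    error. The constant is [2 ^ 4] subsets [A] times [2 ^ 4] from [a f <= 2 * w f]. *)
Lemma expect_major_prod F : (#|F| <= 4)%N ->
  expect p (fun W => \prod_(f in F) major W f) <=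
  \prod_(f in F) w f + 256%:R * ((\prod_(f in F) w f) * overlap F).
Proof.
move=> F4; under eq_expect => W do rewrite prodrD_subsets.
rewrite expect_sum.
apply: (@le_trans _ _ (\sum_(A in powerset F)
   ((\prod_(f in A) p f) * (\prod_(f in F :\: A) ((1 - del) * w f)) +
    2%:R ^+ 4 * ((\prod_(f in F) w f) * overlap F)))); last first.
  rewrite big_split /= -prodrD_subsets; apply: lerD.
    by rewrite le_eqVlt; apply/orP; left; apply/eqP; apply: eq_bigr => f _; rewrite /p; ring.
  rewrite sumr_const -[leLHS]mulr_natl mulrA card_powerset; apply: ler_wpM2r.
    by rewrite mulr_ge0 ?overlap_ge0 // prodr_ge0.
  rewrite (_ : 256%:R = 2%:R ^+ 4 * 2%:R ^+ 4 :> R); last by ring.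
  by rewrite ler_wpM2r ?exprn_ge0 // natrX ler_weXn2l // ler1n.
apply: ler_sum => A; rewrite powersetE => sAF.
pose G := F :\: A; pose D := \bigcup_(f in G) H f.
have -> : expect p (fun W => (\prod_(f in A) (f \in W)%:R) *
      \prod_(f in G) ([disjoint H f & W]%:R * a f)) =
    (\prod_(f in G) a f) * expect p (fun W => ((A \subset W) && [disjoint D & W])%:R).
  rewrite -expectZ; apply: eq_expect => W; rewrite big_split /= mulrA mulrC; congr (_ * _).
  case: (boolP (_ && _)) => [/andP[/subsetP sAW dDW]|].
    rewrite !big1 ?mulr1 // => f; last by move/sAW ->.
    move=> fG; suff -> : [disjoint H f & W] by [].
    by apply: disjointWl dDW; apply: bigcup_sup.
  rewrite negb_and => /orP[/subsetPn[f fA fW]|].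
    by rewrite (bigD1 f fA) /= (negbTE fW) !mul0r.
  rewrite -setI_eq0 => /set0Pn[g /setIP[/bigcupP[f fG gH] gW]].
  rewrite (bigD1 f fG) /= (_ : [disjoint _ & _] = false) ?mul0r ?mulr0 //.
  by apply/negbTE; rewrite -setI_eq0; apply/set0Pn; exists g; rewrite in_setI gH.
have sGF : G \subset F by apply: subsetDl.
have aG0 : 0 <= \prod_(f in G) a f by rewrite prodr_ge0.
have pA0 : 0 <= \prod_(f in A) p f by rewrite prodr_ge0.
apply: le_trans (ler_wpM2l aG0 (expect_cylinder_le A D p_prob)) _.
rewrite mulrCA; apply: (@le_trans _ _ ((\prod_(f in A) p f) * ((\prod_(f in G) a f) *
   (\prod_(f in G) q (H f) + overlap F)))).
  do 2![apply: ler_wpM2l => //]; apply: le_trans (avoid_prob_bigcup_le H G p_prob) _.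
  rewrite lerD2l; apply: le_trans (overlap_sub sGF); do 3![apply: ler_sum => ? _].
  exact: p_le.
rewrite !mulrDr; apply: lerD.
  by rewrite -big_split /= (eq_bigr _ (fun f _ => a_q f)).
have aw : \prod_(f in G) a f <= 2%:R ^+ 4 * \prod_(f in G) w f.
  apply: (@le_trans _ _ (\prod_(f in G) (2%:R * w f))).
    by apply: ler_prod => f _; rewrite a_ge0 a_le.
  rewrite big_split /= prodr_const ler_wpM2r ?prodr_ge0 //.
  by rewrite ler_weXn2l ?ler1n // (leq_trans (subset_leq_card sGF)).
rewrite !mulrA ler_wpM2r ?overlap_ge0 //.
rewrite [\prod_(f in F) w f](big_setID A) /= (setIidPr sAF) -/G mulrCA; apply: ler_pM => //.
  by apply: ler_prod => f _; rewrite p0 p_le.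
Qed.

(* The constant bounds the number of [(K, f, f', g)] inside a family of 10 edges. *)
Lemma overlap_le_bad :
  \sum_(K in conf | (2 < #|K|)%N) mono U w K * overlap (K :\: U) <=
  (2 ^ 10 * 1000)%:R * bad_weight U w.
Proof.
pose P (i : ({set E} * E) * (E * E)) := [&& (i.1.1 \in conf) && (2 < #|i.1.1|)%N,
  i.1.2 \in i.1.1 :\: U, i.2.1 \in i.1.1 :\: U, i.2.1 != i.1.2 &
  i.2.2 \in H i.1.2 :&: H i.2.1].
apply: (@le_trans _ _ (\sum_(i | P i) mono U w i.1.1 * w i.2.2)).
  rewrite le_eqVlt; apply/orP; left; apply/eqP.
  rewrite [RHS](eq_bigl (fun i => ((i.1.1 \in conf) && (2 < #|i.1.1|)%N && (i.1.2 \in i.1.1 :\: U)) &&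
     (((i.2.1 \in i.1.1 :\: U) && (i.2.1 != i.1.2)) && (i.2.2 \in H i.1.2 :&: H i.2.1)))); last first.
    by move=> i; rewrite /P -!andbA.
  rewrite -(pair_big_dep (fun k : {set E} * E => (k.1 \in conf) && (2 < #|k.1|)%N && (k.2 \in k.1 :\: U))
     (fun (k : {set E} * E) (j : E * E) => (((j.1 \in k.1 :\: U) && (j.1 != k.2)) && (j.2 \in H k.2 :&: H j.1)))
     (fun k j => mono U w k.1 * w j.2)) /=.
  rewrite -(pair_big_dep (fun K : {set E} => (K \in conf) && (2 < #|K|)%N)
     (fun K f => f \in K :\: U) (fun K f => \sum_(j | (((j.1 \in K :\: U) && (j.1 != f)) && (j.2 \in H f :&: H j.1))) mono U w K * w j.2)) /=.
  apply: eq_bigr => K _; rewrite mulr_sumr; apply: eq_bigr => f _.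
  rewrite -(pair_big_dep (fun f' => (f' \in K :\: U) && (f' != f))
     (fun f' g => g \in H f :&: H f') (fun f' g => mono U w K * w g)) /=.
  by rewrite mulr_sumr; apply: eq_bigr => f' _; rewrite mulr_sumr.
apply: (@sum_le_bad_weight U w _ P _ (fun F i =>
   (i \in setX (setX (powerset F) F) (setX F F)))) => //.
  move=> [[K f] [f' g]]; rewrite /P /= => /and5P[/andP[Kc K3]].
  rewrite 2!in_setD => /andP[fU fK] /andP[f'U f'K] f'f /setIP[].
  move=> /threatP[K1 [gU gf K1c [fK1 gK1 sK1]]] /threatP[K2 [_ gf' K2c [fK2 gK2 sK2]]].
  have nK1 : f' \notin K1.
    by apply: contra f'U => f'K1; rewrite (subsetP sK1) // !in_setD1 f'f f'K1 eq_sym gf'.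
  have nK2 : f \notin K2.
    by apply: contra fU => f'K2; rewrite (subsetP sK2) // !in_setD1 [f == f']eq_sym f'f f'K2 [f == g]eq_sym gf.
  exists (K :|: K1 :|: K2).
    by apply: (bad_cycle (f := f) (f' := f') (g := g)); rewrite // eq_sym.
  rewrite !inE fK f'K gK1 !orbT !andbT /= -setUA subsetUl /=.
  rewrite !mono_setD.
  have -> : w g = \prod_(k in [set g]) w k by rewrite big_set1.
  apply: le_trans (prod_setU_ge _ _ w01) _.
  (* Apart from [f], [f'] and [g] the conflicts [K1] and [K2] lie in [U], so outside [U] the union
     consists of [K] and [g]. *)
  rewrite [leRHS](_ : _ = \prod_(k in ((K :\: U) :|: [set g])) w k) //.
  apply: eq_bigl => k; rewrite !inE.
  case: (boolP (k \in U)) => kU /=; first by case: eqP => // kg; rewrite -kg kU in gU.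
  case: (boolP (k \in K)) => //= kK.
  have [->|kg] := eqVneq k g; first by rewrite gK1.
  apply/negbTE; rewrite negb_or; apply/andP; split; apply: contra kU => kKi.
    by rewrite (subsetP sK1) // !in_setD1 kg kKi andbT /=; apply: contraNneq kK => ->.
  by rewrite (subsetP sK2) // !in_setD1 kg kKi andbT /=; apply: contraNneq kK => ->.
move=> F /bad_card F10; rewrite (_ : [set i | _] = setX (setX (powerset F) F) (setX F F)).
  rewrite !cardsX card_powerset -mulnA; apply: leq_mul; first by rewrite leq_exp2l.
  by rewrite -(_ : 10 * (10 * 10) = 1000)%N // !leq_mul.
by apply/setP => i; rewrite inE.
Qed.

Lemma expect_conf_weight :
  expect p (fun W => conf_weight (next_set W) (next_weight W)) <=
  conf_weight U w + (256 * (2 ^ 10 * 1000))%:R * bad_weight U w.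
Proof.
rewrite expect_sum natrM -mulrA.
apply: le_trans (_ : _ <= conf_weight U w + 256%:R *
  (\sum_(K in conf | (2 < #|K|)%N) mono U w K * overlap (K :\: U))) _; last first.
  by rewrite lerD2l ler_wpM2l // overlap_le_bad.
rewrite mulr_sumr -big_split; apply: ler_sum => K /andP[Kc K3] /=.
rewrite mono_setD.
apply: le_trans (_ : _ <= expect p (fun W => \prod_(f in K :\: U) major W f)) _.
  by apply: ler_expect.
apply: expect_major_prod; have /andP[_ K4] := conf_card Kc.
by apply: leq_trans K4; apply: subset_leq_card; apply: subsetDl.
Qed.

(** * Vertices that become overloaded *)

Section Vertex.
Variable u : V.

(** Threats over [u] are left out because [bad_join] controls common threats only outside
    [inc u]. *)
Let A f := H f :\: inc u.
Let Z W := \sum_(f in inc u) a f * [disjoint A f & W]%:R.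
Let m := \sum_(f in inc u) a f * q (A f).

(** Ignoring the threats over [u] raises the survival probability by at most a factor
    [1 / (1 - del)], since the weight at [u] is at most 1; the factor [1 - del] in [boost]
    compensates for this. *)
Let m_le1 : m <= 1.
Proof.
apply: le_trans (st_deg Sw u); apply: ler_sum => f fu.
have [wf|wf] := eqVneq (w f) 0.
  by have := a_le f; rewrite wf mulr0 => a0; apply: mulr_le0_ge0.
have qI : 1 - del <= q (H f :&: inc u).
  apply: le_trans (avoid_prob_ge p_prob _); rewrite lerD2l lerN2 -mulr_sumr.
  rewrite ler_piMr //; apply: le_trans (st_deg Sw u).
  rewrite [leRHS](big_setID (H f)) /= setIC -[leLHS]addr0 lerD2l.
  by apply: sumr_ge0.
have eq : q (H f) = q (H f :&: inc u) * q (A f) by rewrite /q /avoid_prob (big_setID (inc u)).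
have q0 := q_gt0 wf.
rewrite /a /boost -/q mulrAC ler_pdivrMr // eq.
have := ler_wpM2l (mulr_ge0 (w0 f) (q_ge0 (A f))) qI.
rewrite (_ : w f * _ * (1 - del) = (1 - del) * w f * q (A f)); last by ring.
by rewrite (_ : w f * _ * _ = w f * (q (H f :&: inc u) * q (A f))); last by ring.
Qed.

Let full_le W : u \in full W -> 1 + eta <= Z W.
Proof.
rewrite inE => /ltW lt; apply: le_trans lt _; apply: ler_sum => f fu.
rewrite /next_weight; case: ifP => [_|/negbT]; first exact: mulr_ge0.
rewrite !negb_or => /and3P[_ _ /blocked_disjoint dH].
rewrite (_ : [disjoint A f & W]) ?mulr1 //.
by apply: disjointWl dH; apply: subsetDl.
Qed.

(* Chebyshev's inequality for [Z], whose mean [m] is at most 1. *)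
Lemma expect_full : expect p (fun W => (u \in full W)%:R) <= eta ^- 2 * (4%:R *
  (\sum_(f in inc u) \sum_(f' in inc u | f' != f) w f * w f' *
     \sum_(g in (H f :&: H f') :\: inc u) w g) + 4%:R * mu * \sum_(f in inc u) w f).
Proof.
apply: (@le_trans _ _ (eta ^- 2 * expect p (fun W => (Z W - m) ^+ 2))).
  rewrite -expectZ; apply: ler_expect => // W.
  case: (boolP (u \in full W)) => uF; last by rewrite mulr_ge0 ?invr_ge0 ?sqr_ge0 ?exprn_ge0 // ltW.
  rewrite mulrC ler_pdivlMr ?exprn_gt0 // mul1r; apply: lerXn2r; rewrite ?nnegrE //; try exact: ltW.
    by have := full_le uF; have := m_le1; have := eta0; lra.
  by have := full_le uF; have := m_le1; have := eta0; lra.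
apply: ler_wpM2l; first by rewrite invr_ge0 exprn_ge0 // ltW.
have EZ : expect p Z = m.
  by rewrite expect_sum; apply: eq_bigr => f _; rewrite expectZ expect_avoid.
have EZ2 : expect p (fun W => (Z W) ^+ 2) = \sum_(f in inc u) \sum_(f' in inc u)
    a f * a f' * q (A f :|: A f').
  transitivity (expect p (fun W => \sum_(f in inc u) \sum_(f' in inc u)
      a f * a f' * [disjoint A f :|: A f' & W]%:R)).
    apply: eq_expect => W; rewrite expr2 /Z big_distrlr /=.
    apply: eq_bigr => f _; apply: eq_bigr => f' _; rewrite mulrACA; congr (_ * _).
    rewrite -!setI_eq0 setIUl setU_eq0.
    by case: (_ == _); rewrite ?mul0r ?mul1r.
  rewrite expect_sum; apply: eq_bigr => f _; rewrite expect_sum.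
  by apply: eq_bigr => f' _; rewrite expectZ expect_avoid.
rewrite (_ : expect p (fun W => (Z W - m) ^+ 2) = expect p (fun W => (Z W) ^+ 2) - m ^+ 2); last first.
  rewrite (@eq_expect _ _ _ _ (fun W => (Z W) ^+ 2 - ((2%:R * m) * Z W - m ^+ 2))) => [|W]; last by ring.
  by rewrite !expectB expectZ expect_cst EZ; ring.
rewrite EZ2 /m expr2 big_distrlr /= -sumrB mulr_sumr [4%:R * mu * _]mulr_sumr -big_split /=.
(* Off the diagonal the covariance is bounded through common threats, on the diagonal by
   [a f * a f]; both factors 4 come from [a f <= 2 * w f]. *)
apply: ler_sum => f fu; rewrite -sumrB (bigD1 f) //= addrC; apply: lerD.
  rewrite mulr_sumr; apply: ler_sum => f' /andP[f'u f'f].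
  have := avoid_probU_le p_prob (A f) (A f'); rewrite -/q.
  have -> : A f :&: A f' = (H f :&: H f') :\: inc u.
    by apply/setP => g; rewrite !inE; case: (g \in inc u); rewrite ?andbF.
  have : \sum_(g in (H f :&: H f') :\: inc u) p g <= \sum_(g in (H f :&: H f') :\: inc u) w g.
    by apply: ler_sum => g _; apply: p_le.
  set sp := \sum_(_ in _) p _; set sw := \sum_(_ in _) w _ => sle qle.
  have sw0 : 0 <= sw by apply: sumr_ge0.
  apply: (@le_trans _ _ (a f * a f' * sw)).
    rewrite [X in _ - X]mulrACA -mulrBr; apply: ler_wpM2l; first by rewrite mulr_ge0.
    by move: qle sle; lra.
  rewrite mulrA ler_wpM2r // mulrA (_ : 4%:R * w f * w f' = (2%:R * w f) * (2%:R * w f')); last by ring.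
  by rewrite ler_pM.
rewrite setUid; apply: (@le_trans _ _ (a f * a f)).
  rewrite lerBlDr; apply: (@le_trans _ _ (a f * a f)).
    by apply: ler_piMr; [apply: mulr_ge0|apply: q_le1].
  have aq0 : 0 <= a f * q (A f) by apply: mulr_ge0; [apply: a_ge0|apply: q_ge0].
  by rewrite lerDl; apply: mulr_ge0.
apply: (@le_trans _ _ ((2%:R * w f) * (2%:R * w f))); first by rewrite ler_pM.
by have := ler_wpM2r (w0 f) (st_max Sw f); nra.
Qed.

End Vertex.

(** Two edges over [u] with a common threat outside [inc u] give a bad family by [bad_join]. A
    triple is counted for at most [s] vertices, and a family of at most 10 edges holds at most 1000
    triples. *)
Lemma join_le_bad :
  \sum_u \sum_(f in inc u) \sum_(f' in inc u | f' != f) w f * w f' *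
     (\sum_(g in (H f :&: H f') :\: inc u) w g) <=
  (s * 1000)%:R * bad_weight U w.
Proof.
pose Q u (i : E * (E * E)) := [&& i.1 \in inc u, i.2.1 \in inc u, i.2.1 != i.1 &
  i.2.2 \in (H i.1 :&: H i.2.1) :\: inc u].
apply: (@le_trans _ _ (\sum_u \sum_(i | Q u i && (i.1 \notin U) && (i.2.1 \notin U))
   w i.1 * w i.2.1 * w i.2.2)).
  apply: ler_sum => u _.
  have -> : \sum_(i | Q u i && (i.1 \notin U) && (i.2.1 \notin U)) w i.1 * w i.2.1 * w i.2.2 =
      \sum_(i | Q u i) w i.1 * w i.2.1 * w i.2.2.
    rewrite [RHS](bigID (fun i => (i.1 \notin U) && (i.2.1 \notin U))) /=.
    rewrite [X in _ = _ + X]big1 ?addr0; first by apply: eq_bigl => i; rewrite andbA.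
    move=> i /andP[_]; rewrite negb_and !negbK => /orP[] /(st_out Sw) ->.
      by rewrite !mul0r.
    by rewrite mulr0 mul0r.
  rewrite (eq_bigl (fun i => (i.1 \in inc u) && (((i.2.1 \in inc u) && (i.2.1 != i.1)) &&
     (i.2.2 \in (H i.1 :&: H i.2.1) :\: inc u)))); last first.
    by move=> i; rewrite /Q -!andbA.
  rewrite -(pair_big_dep (fun f => f \in inc u)
     (fun f j => ((j.1 \in inc u) && (j.1 != f)) && (j.2 \in (H f :&: H j.1) :\: inc u))
     (fun f j => w f * w j.1 * w j.2)) /=.
  apply: ler_sum => f _.
  rewrite -(pair_big_dep (fun f' => (f' \in inc u) && (f' != f))
     (fun f' g => g \in (H f :&: H f') :\: inc u) (fun f' g => w f * w f' * w g)) /=.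
  by apply: ler_sum => f' _; rewrite mulr_sumr.
rewrite (exchange_big_dep predT) //= natrM -mulrA.
apply: (@le_trans _ _ (\sum_(i | [exists u, Q u i && (i.1 \notin U) && (i.2.1 \notin U)])
   s%:R * (w i.1 * w i.2.1 * w i.2.2))).
  rewrite [leLHS](bigID (fun i => [exists u, Q u i && (i.1 \notin U) && (i.2.1 \notin U)])) /=.
  rewrite [X in _ + X]big1 ?addr0; last first.
    by move=> i /existsPn nQ; rewrite big_pred0 // => u; apply/negbTE/nQ.
  apply: ler_sum => i _; rewrite sumr_const -[leLHS]mulr_natl.
  rewrite ler_wpM2r ?mulr_ge0 // ler_nat; apply: leq_trans (inc_card i.1).
  apply: subset_leq_card.
  by apply/subsetP => u; rewrite !inE => /andP[/andP[/and4P[]]].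
rewrite -mulr_sumr ler_wpM2l //.
apply: (@sum_le_bad_weight U w _ _ _ (fun F i => i \in setX F (setX F F))) => //.
  move=> [f [f' g]] /existsP[u] /=; rewrite /Q /= => /andP[/andP[/and4P[fu f'u f'f]]].
  rewrite in_setD in_setI => /andP[gu /andP[]].
  move=> /threatP[K1 [gU gf K1c [fK1 gK1 sK1]]] /threatP[K2 [_ gf' K2c [fK2 gK2 sK2]]] fU f'U.
  exists (K1 :|: K2).
    by apply: (bad_join (u := u) (f := f) (f' := f') (g := g)) => //; rewrite eq_sym.
  rewrite !inE fK1 fK2 gK1 !orbT /= mono_setD.
  have -> : w f * w f' * w g = \prod_(k in [set f; f'; g]) w k.
    rewrite -setUA big_setU1 ?big_setU1 ?big_set1 //=; first by rewrite mulrA.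
      by rewrite inE eq_sym.
    by rewrite !inE negb_or eq_sym f'f eq_sym gf.
  rewrite le_eqVlt; apply/orP; left; apply/eqP; apply: eq_bigl => k; rewrite !inE.
  have [->|kf] := eqVneq k f; first by rewrite fU fK1.
  have [->|kf'] := eqVneq k f'; first by rewrite f'U fK2 !orbT.
  have [->|kg] := eqVneq k g; first by rewrite gU gK1.
  apply/esym/negbTE; rewrite negb_and negbK; case: (boolP (k \in U)) => //= kU.
  rewrite negb_or; apply/andP; split; apply: contra kU => kKi.
    by rewrite (subsetP sK1) // !in_setD1 kg kf kKi.
  by rewrite (subsetP sK2) // !in_setD1 kg kf' kKi.
move=> F /bad_card F10; rewrite (_ : [set i | _] = setX F (setX F F)).
  by rewrite !cardsX -(_ : 10 * (10 * 10) = 1000)%N // !leq_mul.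
by apply/setP => i; rewrite inE.
Qed.

Lemma sum_inc : \sum_u \sum_(f in inc u) w f <= s%:R * \sum_f w f.
Proof.
rewrite (exchange_big_dep predT) //= mulr_sumr; apply: ler_sum => f _.
by rewrite sumr_const -[leLHS]mulr_natl ler_wpM2r // ler_nat -cardsE inc_card.
Qed.

Lemma expect_card_full : expect p (fun W => #|full W|%:R) <=
  eta ^- 2 * (4%:R * (s * 1000)%:R * bad_weight U w + 4%:R * mu * s%:R * \sum_f w f).
Proof.
rewrite (@eq_expect _ _ _ _ (fun W => \sum_u (u \in full W)%:R)) => [|W]; last first.
  by rewrite -sum1_card natr_sum big_mkcond; apply: eq_bigr => u _; case: ifP.
rewrite expect_sum.
apply: le_trans (ler_sum _ (fun u _ => expect_full u)) _.
rewrite -mulr_sumr; apply: ler_wpM2l; first by rewrite invr_ge0 exprn_ge0 // ltW.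
rewrite big_split /= -!mulr_sumr.
apply: lerD; first by rewrite -mulrA ler_wpM2l // join_le_bad.
by rewrite -[leRHS]mulrA; apply: ler_wpM2l sum_inc; apply: mulr_ge0.
Qed.

(** Scaling keeps a fraction [1 / (1 + eta)], at least [1 - eta]. Clearing an overloaded vertex
    costs at most 2, as weights at most double in a round. *)
Lemma trim_sum_ge W : (1 - eta) * (\sum_f next_weight W f) - 2%:R * #|full W|%:R <=
  \sum_f next_weight_trim W f.
Proof.
have [e0 e1] := andP eta01.
apply: (@le_trans _ _ (\sum_f ((1 - eta) * next_weight W f -
    \sum_(u in full W | f \in inc u) next_weight W f))).
  rewrite sumrB -mulr_sumr lerD2l lerN2 (exchange_big_dep (mem (full W))) /=; last first.
    by move=> f u _ /andP[].
  rewrite -sum1_card natr_sum mulr_sumr; apply: ler_sum => u uF; rewrite mulr1.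
  rewrite (eq_bigl (fun f => f \in inc u)) => [|f]; last by rewrite uF.
  apply: (@le_trans _ _ (\sum_(f in inc u) 2%:R * w f)).
    by apply: ler_sum => f _; apply: next_weight_le.
  by rewrite -mulr_sumr ler_piMr // (st_deg Sw).
apply: ler_sum => f _; rewrite /next_weight_trim; have nw := next_weight_ge0 W f.
case: ifP => [/existsP[u /andP[uF fu]]|_].
  rewrite (bigD1 u) /=; last by rewrite uF.
  set X := \sum_(_ | _) _; have : 0 <= X by apply: sumr_ge0.
  have := mulr_ge0 (ltW e0) nw; lra.
set X := \sum_(_ in _ | _) _; have X0 : 0 <= X by apply: sumr_ge0.
rewrite lerBlDr (le_trans _ (_ : next_weight W f / (1 + eta) <= _)) //; last by rewrite lerDl.
rewrite ler_pdivlMr ?addr_gt0 //; have := mulr_ge0 nw (sqr_ge0 eta); rewrite expr2; nra.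
Qed.

(** The expectation of a linear potential is bounded term by term, and some outcome attains it. The
    coefficient of [bad_weight] on the left collects the error terms and yields the recursion of
    [bad_cost]. *)
Lemma nibble_round gam A L : 0 <= gam <= 1 -> 0 <= A -> 0 <= L ->
  exists W, #|U|%:R + (del * (1 - del * h) +
      gam * ((1 - eta) * (1 - del - mu - 2%:R * del ^+ 2 * lam)) -
      eta ^- 2 * (8%:R * mu * s%:R)) * (\sum_f w f) -
    A * conf_weight U w -
    (A * (256 * (2 ^ 10 * 1000))%:R + L * 3%:R ^+ 10 +
       eta ^- 2 * (8%:R * (s * 1000)%:R)) * bad_weight U w
  <= #|next_set W|%:R + gam * (\sum_f next_weight_trim W f) -
     A * conf_weight (next_set W) (next_weight_trim W) -
     L * bad_weight (next_set W) (next_weight_trim W).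
Proof.
move=> /andP[g0 g1] A0 L0; have [e0 e1] := andP eta01.
pose G W := #|next_set W|%:R + gam * (1 - eta) * (\sum_f next_weight W f) -
  2%:R * #|full W|%:R - A * conf_weight (next_set W) (next_weight W) -
  L * bad_weight (next_set W) (next_weight W).
have EG : expect p G = expect p (fun W => #|next_set W|%:R) +
   gam * (1 - eta) * expect p (fun W => \sum_f next_weight W f) -
   2%:R * expect p (fun W => #|full W|%:R) -
   A * expect p (fun W => conf_weight (next_set W) (next_weight W)) -
   L * expect p (fun W => bad_weight (next_set W) (next_weight W)).
  by rewrite /G !expectB expectD !expectZ.
have le1 := expect_next_card.
have le2 : (\sum_f w f) * (1 - del - mu - 2%:R * del ^+ 2 * lam) <=
    expect p (fun W => \sum_f next_weight W f).
  by rewrite expect_sum mulr_suml; apply: ler_sum => f _; apply: expect_next_weight.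
have le3 := expect_card_full.
have le4 := ler_wpM2l A0 expect_conf_weight.
have le5 := ler_wpM2l L0 expect_bad_weight.
have ge0 : 0 <= gam * (1 - eta) by rewrite mulr_ge0 // subr_ge0.
have le2' := ler_wpM2l ge0 le2.
have [W GW] : exists W, expect p G <= G W by apply: expect_attained (lexx _).
exists W; apply: (@le_trans _ _ (expect p G)).
  rewrite EG; move: le1 le2' le3 le4 le5.
  move: (expect p _) (expect p _) (expect p _) (expect p _) (expect p _).
  move: (eta ^- 2) (\sum_f w f) (conf_weight U w) (bad_weight U w).
  rewrite !natrM => i X c b x1 x2 x3 x4 x5.
  nra.
apply: le_trans GW _; rewrite /G.
have lec : conf_weight (next_set W) (next_weight_trim W) <= conf_weight (next_set W) (next_weight W).
  by apply: ler_conf_weight => f; rewrite ?trim_ge0 ?trim_le.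
have leb : bad_weight (next_set W) (next_weight_trim W) <= bad_weight (next_set W) (next_weight W).
  by apply: ler_bad_weight => f; rewrite ?trim_ge0 ?trim_le.
have := ler_wpM2l g0 (trim_sum_ge W); have := ler_wpM2l A0 lec; have := ler_wpM2l L0 leb.
have : 0 <= (1 - gam) * #|full W|%:R by rewrite mulr_ge0 // subr_ge0.
lra.
Qed.

End Step.

(* Dropping an edge [f] with [lam < conf_at U w f] loses [w f], but it also removes
   at least [lam * w f / 4] from [conf_weight]. *)
Lemma prune_state U w mu lam : state U w mu -> mu <= 1 -> 0 < lam ->
  exists w', [/\ state U w' mu, forall f, w' f <= w f,
    forall f, w' f != 0 -> conf_at U w' f <= lam,
    forall gam, gam <= 1 -> gam * (\sum_f w f) - 4%:R / lam * conf_weight U w <=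
      gam * (\sum_f w' f) - 4%:R / lam * conf_weight U w' &
    bad_weight U w' <= bad_weight U w].
Proof.
move=> Uw mu1 lam0; pose D := [set f | (w f != 0) && (lam < conf_at U w f)].
pose w' f := if f \in D then 0 else w f.
have w0 f : 0 <= w f := st_ge0 Uw f.
have w'0 f : 0 <= w' f by rewrite /w'; case: ifP.
have w'w f : w' f <= w f by rewrite /w'; case: ifP.
have w01 f : 0 <= w f <= 1 by rewrite w0 (le_trans (st_max Uw f)).
have w'neq0 f : w' f != 0 -> (w f != 0) && (f \notin D).
  by rewrite /w'; case: (boolP (f \in D)); rewrite ?eqxx ?andbT.
exists w'; split=> //.
- split=> // [f|f fU||f|u].
  + by apply: le_trans (st_max Uw f).
  + by apply/eqP; rewrite eq_le w'0 andbT -(st_out Uw fU).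
  + exact: st_free Uw.
  + by move=> /w'neq0/andP[wf _]; apply: st_ext Uw _ wf.
  + by apply: le_trans (st_deg Uw u); apply: ler_sum.
- move=> f /w'neq0/andP[wf]; rewrite inE wf /= -leNgt; apply: le_trans.
  by apply: ler_sum => K _; apply: ler_mono.
- move=> gam g1; rewrite -subr_ge0.
  have -> : gam * (\sum_f w' f) - 4%:R / lam * conf_weight U w' -
      (gam * (\sum_f w f) - 4%:R / lam * conf_weight U w) =
    4%:R / lam * (conf_weight U w - conf_weight U w') - gam * (\sum_f (w f - w' f)).
    by rewrite sumrB; ring.
  have -> : \sum_f (w f - w' f) = \sum_(f in D) w f.
    rewrite [RHS]big_mkcond; apply: eq_bigr => f _; rewrite /w'.
    by case: ifP => _; rewrite ?subr0 ?subrr.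
  have le1 : lam * (\sum_(f in D) w f) <=
      \sum_(K in conf | (2 < #|K|)%N) \sum_(f in K | f \in D) mono U w K.
    rewrite mulr_sumr (exchange_big_dep (mem D)) /=; last by move=> K f _ /andP[].
    apply: ler_sum => f fD; have := fD; rewrite inE => /andP[wf /ltW lef].
    rewrite mulrC; apply: le_trans (ler_wpM2l (w0 f) lef) _.
    rewrite /conf_at mulr_sumr le_eqVlt; apply/orP; left; apply/eqP.
    apply: eq_big => [K|K /andP[_ /andP[fK _]]].
      move: fD; rewrite inE /conf_at => ->.
      by rewrite andbT -andbA; congr (_ && _); rewrite andbC.
    rewrite /mono [RHS](big_setD1 f fK) /= /mix ifN //.
    by apply: contra wf => fU; rewrite (st_out Uw).
  have le2 : \sum_(K in conf | (2 < #|K|)%N) \sum_(f in K | f \in D) mono U w K <=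
      4%:R * (conf_weight U w - conf_weight U w').
    rewrite -sumrB mulr_sumr; apply: ler_sum => K /andP[Kc _].
    have monoK : 0 <= mono U w K - mono U w' K by rewrite subr_ge0 ler_mono.
    rewrite sumr_const -[leLHS]mulr_natl.
    have [f /andP[fK fD]|K0] := pickP (fun f => (f \in K) && (f \in D)); last first.
      by rewrite (eq_card0 K0) mul0r mulr_ge0.
    have -> : mono U w' K = 0.
      rewrite /mono (bigD1 f fK) /= /mix ifN; first by rewrite /w' fD mul0r.
      move: fD; rewrite inE => /andP[wf _]; apply: contra wf => fU.
      by rewrite (st_out Uw).
    rewrite subr0; apply: ler_wpM2r; first exact: mono_ge0.
    rewrite ler_nat; have /andP[_] := conf_card Kc; apply: leq_trans.
    by apply: subset_leq_card; apply/subsetP => g /andP[].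
  rewrite subr_ge0; apply: (@le_trans _ _ (\sum_(f in D) w f)).
    by rewrite ler_piMl // sumr_ge0.
  by rewrite mulrAC ler_pdivlMr // mulrC (le_trans le1).
- exact: ler_bad_weight.
Qed.

(** * Iterating the rounds *)

Section Iterate.
Variables (mu lam del eta : R).
Let h := s%:R + lam.
(** The shortfall from the ideal gain [del] of a round: blocked selections, trimming, the losses in
    [expect_next_weight] beyond [del], and overloaded vertices. *)
Definition round_loss : R := del ^+ 2 * h + eta + mu + 2%:R * del ^+ 2 * lam + eta ^- 2 * (8%:R * mu * s%:R).

Let loss := round_loss.

(** The coefficient of [bad_weight] in the potential with [j] rounds to go; [4 / lam] is the
    coefficient of [conf_weight] dictated by [prune_state]. *)
Definition bad_cost j : R := iter j (fun L => 4%:R / lam * (256 * (2 ^ 10 * 1000))%:R +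
  L * 3%:R ^+ 10 + eta ^- 2 * (8%:R * (s * 1000)%:R)) 0.

Lemma bad_cost_ge0 j : 0 <= lam -> 0 <= eta -> 0 <= bad_cost j.
Proof.
move=> lam0 eta0; have A0 : 0 <= 4%:R / lam by apply: divr_ge0.
rewrite /bad_cost; elim: j => [|j IHj] //=.
apply: addr_ge0; last by rewrite mulr_ge0 ?invr_ge0 ?exprn_ge0 // mulr_ge0.
apply: addr_ge0; first exact: mulr_ge0.
by apply: mulr_ge0 => //; apply: exprn_ge0.
Qed.

(** Induction on the number [k] of rounds to go. The bound on single weights may double each round,
    hence the hypothesis on [2 ^ k * m]; pruning restores the bound [lam] before each round. *)
Theorem weighted_nibble k U w m : 0 < lam -> 0 < del -> del * h <= 1 / 2%:R ->
  del <= 1 / 2%:R -> 0 < eta <= 1 -> 0 <= mu <= 1 -> loss <= del ->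
  state U w m -> 2%:R ^+ k * m <= mu ->
  exists U', [/\ conf_free U', forall f, f \in U' -> f \notin U -> w f != 0 &
    #|U|%:R + (1 - loss / del) * (1 - (1 - del) ^+ k) * (\sum_f w f) -
      4%:R / lam * conf_weight U w - bad_cost k * bad_weight U w <= #|U'|%:R].
Proof.
move=> lam0 del0 del_h del12 eta01 /andP[mu0 mu1] loss_del.
have del1 : del <= 1 by lra.
have eta_ge0 : 0 <= eta by case/andP: eta01 => /ltW.
have A0 : 0 <= 4%:R / lam by apply: divr_ge0 => //; apply: ltW.
have cost_ge0 j := bad_cost_ge0 j (ltW lam0) eta_ge0.
move: k U w m.
have trivial_bound k U w m : state U w m -> (\sum_f w f) * (1 - (1 - del) ^+ k) = 0 ->
    #|U|%:R + (1 - loss / del) * (1 - (1 - del) ^+ k) * (\sum_f w f) -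
      4%:R / lam * conf_weight U w - bad_cost k * bad_weight U w <= #|U|%:R.
  move=> Uw s0; rewrite -mulrA [(1 - _ ^+ k) * _]mulrC s0 mulr0 addr0.
  have := mulr_ge0 A0 (conf_weight_ge0 U (st_ge0 Uw)).
  have := mulr_ge0 (cost_ge0 k) (bad_weight_ge0 U (st_ge0 Uw)); lra.
elim=> [|k IH] U w m Uw.
  move=> _; exists U; split; [exact: st_free Uw|by move=> f ->|].
  by apply: trivial_bound Uw _; rewrite expr0 subrr mulr0.
(* The nonnegativity of [m] is read off from an edge, so an empty edge type is treated
   separately. *)
have [f0 _|E0] := pickP (fun _ : E => true); last first.
  move=> _; exists U; split; [exact: st_free Uw|by move=> f ->|].
  apply: trivial_bound Uw _.
  by rewrite big1 ?mul0r // => f _; have := E0 f.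
have m0 : 0 <= m by apply: le_trans (st_max Uw f0); apply: (st_ge0 Uw).
rewrite exprS -mulrA mulrCA => le_mu.
have mmu : m <= mu.
  apply: le_trans le_mu; rewrite mulrA ler_peMl //.
  by apply: mulr_ege1; rewrite ?exprn_ege1 ?ler1n.
have m1 : m <= 1 by apply: le_trans mu1.
have [w' [Uw' w'w atw' dropw bad_w']] := prune_state Uw m1 lam0.
pose gam := (1 - loss / del) * (1 - (1 - del) ^+ k).
have q01 : 0 <= (1 - del) ^+ k <= 1.
  by rewrite exprn_ge0 ?exprn_ile1 ?subr_ge0 // gerBl ltW.
have l01 : 0 <= loss / del <= 1.
  have /andP[e0 _] := eta01.
  have lam0' := ltW lam0; have e0' := ltW e0; have del0' := ltW del0.
  have d2 : 0 <= del ^+ 2 by apply: exprn_ge0.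
  have h0 : 0 <= h by apply: addr_ge0.
  rewrite ler_pdivrMr // mul1r loss_del andbT; apply: divr_ge0 => //.
  rewrite /loss /round_loss; do 4?[apply: addr_ge0 => //]; do ?[apply: mulr_ge0 => //].
  by rewrite invr_ge0 exprn_ge0.
have gam01 : 0 <= gam <= 1.
  case/andP: q01 => q0 q1; case/andP: l01 => l0 l1.
  by rewrite /gam mulr_ge0 ?subr_ge0 // mulr_ile1 ?subr_ge0 // gerBl.
have [W leW] := nibble_round Uw' m0 m1 atw' del0 del_h del12 eta01 gam01 A0 (cost_ge0 k).
have [U' [freeU' suppU' leU']] := IH _ _ _ (trim_state Uw' m1 atw' del0 del_h del12 eta01 W) le_mu.
exists U'; split=> //.
  have supp f : w' f != 0 -> w f != 0.
    move=> w'f; rewrite gt_eqF // (lt_le_trans _ (w'w f)) // lt_def w'f.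
    exact: (st_ge0 Uw').
  move=> f fU' fU; apply: supp; have [fN|/(suppU' f fU')] := boolP (f \in next_set U w' W).
    by move: fN; rewrite in_setU (negbTE fU) inE => /and3P[].
  apply: contra => /eqP w'f; rewrite eq_le (trim_ge0 Uw' m1 del0 del12 eta01) andbT.
  apply: le_trans (trim_le Uw' m1 del0 del12 eta01 W f) _.
  apply: le_trans (next_weight_le Uw' m1 atw' del0 del_h del12 W f) _.
  by rewrite w'f mulr0.
apply: le_trans leU'; apply: le_trans leW; rewrite -/gam.
have gam1 : gam <= 1 by case/andP: gam01.
have w'ge0 : 0 <= \sum_f w' f by apply: sumr_ge0 => f _; apply: (st_ge0 Uw').
pose gam' := (1 - loss / del) * (1 - (1 - del) ^+ k.+1).
have gam'1 : gam' <= 1.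
  have : 0 <= (1 - del) ^+ k.+1 <= 1.
    by rewrite exprn_ge0 ?exprn_ile1 ?subr_ge0 // gerBl ltW.
  case/andP: l01 => l0 l1 /andP[q0 q1].
  by rewrite /gam' mulr_ile1 ?subr_ge0 // gerBl.
(* The coefficient of the total weight solves this recursion with value 0 at [k = 0]. *)
have gam'E : gam' = del - loss + (1 - del) * gam.
  rewrite /gam' /gam exprS; field; exact: lt0r_neq0.
have le1 := dropw _ gam'1.
have lossE : gam' <= del * (1 - del * h) + gam * ((1 - eta) * (1 - del - m - 2%:R * del ^+ 2 * lam)) -
    eta ^- 2 * (8%:R * m * s%:R).
  have e2 : eta ^- 2 * (8%:R * m * s%:R) <= eta ^- 2 * (8%:R * mu * s%:R).
    have /andP[e0 _] := eta01.
    by rewrite ler_wpM2l ?invr_ge0 ?exprn_ge0 ?(ltW e0) // ler_wpM2r // ler_wpM2l.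
  rewrite gam'E /loss /round_loss; move: e2; set x := eta ^- 2 * _; set y := eta ^- 2 * _ => e2.
  case/andP: gam01 => gam0 _; have /andP[e0 e1] := eta01.
  have t0 : 0 <= 2%:R * del ^+ 2 * lam by rewrite !mulr_ge0 ?exprn_ge0 ?ltW.
  move: t0; set t := 2%:R * del ^+ 2 * lam => t0.
  have : gam * (eta + mu + t) <= eta + mu + t by rewrite ler_piMl // !addr_ge0 // ltW.
  have : gam * (1 - del - eta - mu - t) <= gam * ((1 - eta) * (1 - del - m - t)).
    rewrite ler_wpM2l //; have : 0 <= eta * (del + m + t).
      by rewrite mulr_ge0 ?(ltW e0) // !addr_ge0 // ltW.
    rewrite !mulrDr; have := mulr_ge0 (ltW e0) m0; lra.
  rewrite expr2; lra.
have le2 := ler_wpM2r w'ge0 lossE.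
have le3 := ler_wpM2l (cost_ge0 k.+1) bad_w'.
have costS : bad_cost k.+1 = 4%:R / lam * (256 * (2 ^ 10 * 1000))%:R +
  bad_cost k * 3%:R ^+ 10 + eta ^- 2 * (8%:R * (s * 1000)%:R) by [].
rewrite -costS -/gam' -/h.
apply: (@le_trans _ _ (#|U|%:R + gam' * (\sum_f w' f) - 4%:R / lam * conf_weight U w' -
  bad_cost k.+1 * bad_weight U w')); first by move: le1 le3; lra.
by rewrite lerD2r lerD2r lerD2l.
Qed.

End Iterate.
End Nibble.

(** * The lower bound *)

Section Packing.
Variables (R : realFieldType) (n t d : nat).
Hypothesis t2 : (2 <= t)%N.
Hypothesis d0 : (0 < d)%N.
Hypothesis n_large : (2 * (d + t) <= n)%N.
Let r := (d + t)%N.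
Let T := 'I_n.

Definition extensions (u : {set T}) : {set {set T}} :=
  if #|u| == t then [set f : {set T} | (#|f| == r) && (u \subset f)] else set0.

Definition conflicts := [set K : {set {set T}} | conflict t d K].

(** Ten edges suffice: two conflicts have at most eight, and three conflicts in a cycle have at most
    twelve, with two overlaps. *)
Definition short_dense := [set F : {set {set T}} | (#|F| <= 10)%N && oversparse t d F].

(** One over the number of [r]-sets containing a given [t]-set, so that the weights over it add up
    to at most 1. *)
Let W : R := ('C(n - t, d))%:R^-1.

Definition uniform_weight (f : {set T}) : R := if #|f| == r then W else 0.

Let n0 : (0 < n)%N. Proof. by apply: leq_trans n_large; rewrite muln_gt0 addn_gt0 d0. Qed.

Let W_gt0 : 0 < W.
Proof. by rewrite invr_gt0 ltr0n bin_gt0; lia. Qed.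

Definition growth := (d`! * 2 ^ d)%N.

Lemma scaled_weight_le : n%:R ^+ d * W <= growth%:R.
Proof.
rewrite ler_pdivrMr; last by rewrite -invr_gt0.
by rewrite -natrX -natrM ler_nat mulnC bin_ge.
Qed.

Definition family_const B c : R :=
  \sum_(m < B.+1) (2 ^ 2 ^ (m * d + c))%:R * growth%:R ^+ m.

(** There are [O(n ^ (m * d + c))] such families with [m] edges, each of weight at most [W ^ m], and
    [n ^ d * W] is bounded. *)
Lemma family_weight_le (P : pred {set {set T}}) B c :
  (forall F, P F -> (#|F| <= B)%N && (#|cover F| <= #|F| * d + c)%N) ->
  \sum_(F | P F) mono set0 uniform_weight F <= family_const B c * n%:R ^+ c.
Proof.
move=> hP.
apply: (@le_trans _ _ (\sum_(F | P F) W ^+ #|F|)).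
  apply: ler_sum => F _; rewrite /mono -prodr_const; apply: ler_prod => f _.
  rewrite /mix inE /uniform_weight; case: ifP => _; first by rewrite ltW ?lexx.
  by rewrite lexx ltW.
rewrite (partition_big (fun F : {set {set T}} => inord #|F| : 'I_B.+1) predT) //=.
rewrite /family_const mulr_suml; apply: ler_sum => m _.
apply: (@le_trans _ _ (\sum_(F | P F && (inord #|F| == m)) W ^+ m)).
  apply: ler_sum => F /andP[/hP/andP[FB _] /eqP <-].
  by rewrite inordK.
rewrite sumr_const -[leLHS]mulr_natl.
apply: (@le_trans _ _ ((n ^ (m * d + c) * 2 ^ 2 ^ (m * d + c))%:R * W ^+ m)).
  apply: ler_wpM2r; first by rewrite exprn_ge0 // ltW.
  rewrite ler_nat; apply: leq_trans (card_families _ n0); apply: subset_leq_card.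
  apply/subsetP => F; rewrite unfold_in => /andP[/hP/andP[FB Fc] /eqP Fm].
  by rewrite inE (leq_trans Fc) // -Fm inordK.
rewrite natrM natrX exprD exprM.
have -> : (n%:R ^+ m ^+ d * n%:R ^+ c) * (2 ^ 2 ^ (m * d + c))%:R * W ^+ m =
  (2 ^ 2 ^ (m * d + c))%:R * (n%:R ^+ d * W) ^+ m * n%:R ^+ c :> R.
  by rewrite exprMn -!exprM [(d * m)%N]mulnC; ring.
apply: ler_wpM2r; first exact: exprn_ge0.
apply: ler_wpM2l => //; apply: lerXn2r; rewrite ?nnegrE ?ler0n ?scaled_weight_le //.
by rewrite mulr_ge0 ?exprn_ge0 // ltW.
Qed.

Lemma extensions_card f : (#|[set u | f \in extensions u]| <= 'C(r, t))%N.
Proof.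
have [fr|fr] := boolP (#|f| == r); last first.
  rewrite (_ : [set u | _] = set0) ?cards0 //.
  by apply/setP => u; rewrite !inE /extensions; case: ifP => _; rewrite inE ?(negbTE fr).
rewrite -{1}(eqP fr) -cards_draws; apply: subset_leq_card; apply/subsetP => u.
rewrite !inE /extensions; case: ifP => [ut|]; last by rewrite inE.
by rewrite inE andbT => /andP[].
Qed.

Lemma extensions_weight u : \sum_(f in extensions u) uniform_weight f <= 1.
Proof.
have Cpos : 0 < ('C(n - t, d))%:R :> R by rewrite -invr_gt0.
rewrite /extensions; case: ifP => ut; last by rewrite big_set0.
rewrite (eq_bigr (fun=> W)) => [|f]; last by rewrite inE /uniform_weight => /andP[->].
rewrite sumr_const -[leLHS]mulr_natr ler_pdivrMl // mulr1 ler_nat.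
have -> : 'C(n - t, d) = #|[set A : {set T} | (A \subset ~: u) & (#|A| == d)]|.
  by rewrite cards_draws cardsCs setCK card_ord (eqP ut).
rewrite -(@card_in_imset _ _ (fun f : {set T} => f :\: u) [set f : {set T} | (#|f| == r) && (u \subset f)]).
  apply: subset_leq_card; apply/subsetP => A /imsetP[f]; rewrite !inE => /andP[fr uf] ->.
  rewrite subsetDr /=; have := cardsD f u; rewrite (setIidPr uf) (eqP fr) (eqP ut) => ->.
  by rewrite /r addnK.
move=> f g; rewrite !inE => /andP[_ uf] /andP[_ ug] eq.
by rewrite -(setID f u) -(setID g u) (setIidPr uf) (setIidPr ug) eq.
Qed.

Lemma sum_uniform_weight : \sum_f uniform_weight f = ('C(n, r))%:R * W.
Proof.
rewrite /uniform_weight -big_mkcond sumr_const -[LHS]mulr_natl; congr (_%:R * _).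
by rewrite -[in RHS](card_ord n) -card_draws cardsE.
Qed.

Lemma conflicts_card K : K \in conflicts -> (2 <= #|K| <= 4)%N.
Proof. by rewrite inE => /conflictP[_ -> ->]. Qed.

Lemma conflicts_pair K : K \in conflicts -> #|K| = 2 ->
  exists u, K \subset extensions u.
Proof.
rewrite inE => cK K2; have /cards2P[e [f [ef KE]]] : #|K| == 2 by rewrite K2.
have [uK _ _ sK _] := conflictP cK.
have eK : e \in K by rewrite KE !inE eqxx.
have fK : f \in K by rewrite KE !inE eqxx orbT.
have : (t <= #|e :&: f|)%N.
  by rewrite -(sparse_share ef (uK e eK) (uK f fK)) -KE.
rewrite -bin_gt0 -cards_draws card_gt0 => /set0Pn[u]; rewrite inE subsetI.
move=> /andP[/andP[ue uf] ut]; exists u; rewrite /extensions ut KE subUset !sub1set !inE.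
by rewrite uK // uK // eqxx ue uf.
Qed.

Lemma short_dense_join u f f' g K K' : f \in extensions u -> f' \in extensions u ->
  f != f' -> g \notin extensions u -> K \in conflicts -> K' \in conflicts ->
  f \in K -> g \in K -> f' \in K' -> g \in K' -> K :|: K' \in short_dense.
Proof.
rewrite /extensions; case: ifP => [ut|]; last by rewrite inE.
rewrite !inE => /andP[_ uf] /andP[_ uf'] ff' gu cK cK' fK gK fK' gK'.
have [uK _ K4 _ _] := conflictP cK; have [_ _ K'4 _ _] := conflictP cK'.
rewrite (leq_trans (leq_card_setU _ _)) /=; last exact: leq_trans (leq_add K4 K'4) _.
apply: (bad_join_geom (u := u) (e := f) (f := f') (g := g)) => //; first exact/eqP.
by move: gu; rewrite uK // eqxx.
Qed.

Lemma short_dense_cycle f f' g K K1 K2 : K \in conflicts -> K1 \in conflicts ->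
  K2 \in conflicts -> (2 < #|K|)%N -> f \in K -> f' \in K -> f != f' -> g != f ->
  g != f' -> f \in K1 -> g \in K1 -> f' \in K2 -> g \in K2 -> f' \notin K1 ->
  f \notin K2 -> K :|: K1 :|: K2 \in short_dense.
Proof.
rewrite !inE => cK cK1 cK2 K3 fK f'K ff' gf gf' fK1 gK1 f'K2 gK2 f'K1 fK2.
rewrite (bad_cycle_geom cK cK1 cK2 K3 fK f'K ff' gf) // andbT.
have [_ _ K4 _ _] := conflictP cK; have [_ _ K14 _ _] := conflictP cK1.
have [_ _ K24 _ _] := conflictP cK2.
have := cardsUI K K1; have := cardsUI (K :|: K1) K2.
have : (0 < #|K :&: K1|)%N by rewrite card_gt0; apply/set0Pn; exists f; rewrite inE fK.
have : (0 < #|(K :|: K1) :&: K2|)%N.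
  by rewrite card_gt0; apply/set0Pn; exists f'; rewrite !inE f'K.
move: K4 K14 K24; clear; lia.
Qed.

(** The nibble starts with no chosen edge and uniform weights, a state because conflicts have at
    least two edges. The final set contains no conflict, hence no four sparse edges by
    [conflict_sub]. *)
Lemma packing_exists k (lam del eta mu : R) : 0 < lam -> 0 < del ->
  del * (('C(r, t))%:R + lam) <= 1 / 2%:R -> del <= 1 / 2%:R -> 0 < eta <= 1 ->
  0 <= mu <= 1 -> round_loss 'C(r, t) mu lam del eta <= del ->
  2%:R ^+ k * W <= mu ->
  (1 - round_loss 'C(r, t) mu lam del eta / del) * (1 - (1 - del) ^+ k) *
    (('C(n, r))%:R * W) - 4%:R / lam * (family_const 4 t * n%:R ^+ t) -
    bad_cost 'C(r, t) lam eta k * (family_const 10 t.-1 * n%:R ^+ t.-1) <=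
  (bes_number r n (4 * r - 3 * t) 4)%:R.
Proof.
move=> lam0 del0 del_h del1 eta01 mu01 loss_le W_le.
have wW f : 0 <= uniform_weight f <= W.
  by rewrite /uniform_weight; case: ifP => _; rewrite ?lexx ltW.
have cfree (F : {set {set T}}) : (#|F| <= 1)%N -> conf_free conflicts F.
  move=> F1; apply/forallP => K; apply/implyP => /conflicts_card/andP[K2 _].
  by apply/negP => /subset_leq_card KF; have := leq_trans K2 (leq_trans KF F1).
have st : state extensions conflicts set0 uniform_weight W.
  split.
  - by move=> f; case/andP: (wW f).
  - by move=> f; case/andP: (wW f).
  - by move=> f; rewrite inE.
  - by apply: cfree; rewrite cards0.
  - by move=> f _; apply: cfree; rewrite setU0 cards1.
  - exact: extensions_weight.
have bad_card (F : {set {set T}}) : F \in short_dense -> (#|F| <= 10)%N by rewrite inE => /andP[].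
have [U [Ufree Usupp]] := weighted_nibble extensions_card conflicts_card conflicts_pair
  bad_card short_dense_join short_dense_cycle lam0 del0 del_h del1 eta01 mu01 loss_le st W_le.
rewrite cards0 add0r sum_uniform_weight => leU.
have Ur f : f \in U -> #|f| = r.
  move=> /Usupp; rewrite inE => /(_ isT); rewrite /uniform_weight.
  by case: ifP => [/eqP|]; rewrite ?eqxx.
have graph : is_rgraph r U && ~~ has_sparse_subgraph (4 * r - 3 * t) 4 U.
  apply/andP; split; first by apply/forall_inP => f /Ur/eqP.
  apply/existsP => -[F /and3P[FU /eqP F4 Fc]].
  have [||||K cK KF] := @conflict_sub _ t d F.
  - by apply/forall_inP => f fF; apply/eqP/Ur/(subsetP FU).
  - by rewrite F4.
  - by rewrite F4.
  - by rewrite /sparse F4; apply: leq_trans Fc _; rewrite /r four_edge_bound.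
  have := forallP Ufree K; rewrite inE cK /= => /negP; apply.
  exact: subset_trans FU.
have leb : #|U|%:R <= (bes_number r n (4 * r - 3 * t) 4)%:R :> R.
  rewrite ler_nat /bes_number.
  by apply: (@leq_bigmax_cond _ _ (fun E : {set {set T}} => #|E|)).
apply: le_trans leb; apply: le_trans leU; rewrite -!addrA lerD2l -!opprD lerN2.
have [e0 _] := andP eta01.
apply: lerD; apply: ler_wpM2l.
- by apply: divr_ge0 => //; apply: ltW.
- apply: family_weight_le => K /andP[Kc _]; case/andP: (conflicts_card Kc) => _ -> /=.
  by move: Kc; rewrite inE => /conflictP[].
- by apply: bad_cost_ge0 => //; apply: ltW.
(* Oversparse means a span of at most [#|F| * d + t.-1], which saves one power of [n]. *)
- apply: family_weight_le => F; rewrite inE => /andP[-> /=].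
  by rewrite /oversparse ltn_add_pred.
Qed.

End Packing.

(** * Elementary inequalities *)

Lemma bernoulli_ge (R : realFieldType) (x : R) t : 0 <= x <= 1 ->
  1 - t%:R * x <= (1 - x) ^+ t.
Proof.
move=> /andP[x0 x1]; elim: t => [|t IH]; first by rewrite mul0r subr0 expr0.
rewrite exprS; have := ler_wpM2l (_ : 0 <= 1 - x) IH; rewrite subr_ge0 => /(_ x1).
apply: le_trans; rewrite -natr1; have := mulr_ge0 (ler0n R t) (mulr_ge0 x0 x0); nra.
Qed.

Lemma geometric_le (R : realFieldType) (x : R) k : 0 <= x <= 1 ->
  (1 - x) ^+ k * (1 + k%:R * x) <= 1.
Proof.
move=> /andP[x0 x1]; elim: k => [|k IH]; first by rewrite expr0 mul0r addr0 mulr1.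
apply: le_trans IH; rewrite exprSr -mulrA; apply: ler_wpM2l.
  by rewrite exprn_ge0 // subr_ge0.
rewrite -natr1; have := mulr_ge0 (ler0n R k) (mulr_ge0 x0 x0); nra.
Qed.

Lemma bin_natr_ge (R : realFieldType) n t : (0 < n)%N -> (t <= n)%N ->
  n%:R ^+ t * (1 - t%:R * (t%:R / n%:R)) <= t`!%:R * ('C(n, t))%:R :> R.
Proof.
move=> n0 tn; rewrite -natrM mulnC bin_ffact.
have nR : 0 < n%:R :> R by rewrite ltr0n.
have x01 : 0 <= (t%:R / n%:R : R) <= 1.
  by rewrite divr_ge0 //= ler_pdivrMr // mul1r ler_nat.
apply: (@le_trans _ _ (n%:R ^+ t * (1 - t%:R / n%:R) ^+ t)).
  by apply: ler_wpM2l (bernoulli_ge t x01); rewrite exprn_ge0.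
rewrite -exprMn mulrBr mulr1 mulrCA divff ?mulr1; last exact: lt0r_neq0.
by rewrite -natrB // -natrX ler_nat ffact_ge.
Qed.

(** * Upper and lower bounds for the normalised edge number *)

Section Asymptotics.
Variables (R : archiRealFieldType) (t d : nat).
Hypothesis t2 : (1 < t)%N.
Hypothesis d0 : (0 < d)%N.
Let r := (d + t)%N.
Let lim_value : R := (t`!)%:R^-1 * ('C(r, t))%:R^-1.
Let ratio n : R := n%:R ^- t * (bes_number r n (4 * r - 3 * t) 4)%:R.

Let C_gt0 : 0 < ('C(r, t))%:R :> R.
Proof. by rewrite ltr0n bin_gt0 leq_addl. Qed.

Let f_gt0 : 0 < (t`!)%:R :> R.
Proof. by rewrite ltr0n fact_gt0. Qed.

Lemma eventually_small (c eps : R) : 0 < eps ->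
  exists N, forall n, (N <= n)%N -> c / n%:R <= eps.
Proof.
move=> e0; exists (Num.bound (`|c| / eps)).+1 => n le.
have n0 : 0 < n%:R :> R by rewrite ltr0n (leq_trans _ le).
rewrite ler_pdivrMr // mulrC -ler_pdivrMr //.
apply: le_trans (_ : `|c| / eps <= _).
  by rewrite ler_wpM2r ?invr_ge0 ?(ltW e0) // ler_norm.
have c0 : 0 <= `|c| / eps by rewrite divr_ge0 // ltW.
by apply: le_trans (ltW (archi_boundP c0)) _; rewrite ler_nat ltnW.
Qed.

Lemma ratio_le n : (0 < n)%N -> (3 < r)%N -> ratio n <= lim_value + 3%:R / n%:R.
Proof.
move=> n0 r3; have nR : 0 < n%:R :> R by rewrite ltr0n.
have := bes_number_le n t2 d0 r3; rewrite -/r -(ler_nat R) natrM natrD !natrM.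
set b := (bes_number _ _ _ _)%:R => le.
have le1 : ('C(n, t))%:R <= n%:R ^+ t / (t`!)%:R :> R.
  rewrite ler_pdivlMr // -natrM bin_ffact -natrX ler_nat.
  rewrite ffact_prod -[X in (_ <= _ ^ X)%N]card_ord -prod_nat_const.
  by apply: leq_prod => i _; apply: leq_subr.
have le2 : ('C(n, t.-1))%:R <= n%:R ^+ t / n%:R :> R.
  rewrite -{2}(prednK (ltnW t2)) exprSr mulfK ?lt0r_neq0 //.
  rewrite -natrX ler_nat; apply: leq_trans (_ : n ^_ t.-1 <= _)%N.
    by rewrite -bin_ffact leq_pmulr // fact_gt0.
  rewrite ffact_prod -[X in (_ <= _ ^ X)%N]card_ord -prod_nat_const.
  by apply: leq_prod => i _; apply: leq_subr.
rewrite /ratio mulrC ler_pdivrMr ?exprn_gt0 //.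
rewrite -(ler_pM2r C_gt0); apply: le_trans le _.
have -> : (lim_value + 3%:R / n%:R) * n%:R ^+ t * ('C(r, t))%:R =
    n%:R ^+ t / (t`!)%:R + 3%:R * (n%:R ^+ t / n%:R) * ('C(r, t))%:R.
  by rewrite /lim_value; field; rewrite !lt0r_neq0.
by apply: lerD => //; rewrite ler_wpM2r ?(ltW C_gt0) // ler_wpM2l.
Qed.

Lemma lim_value_le1 : 0 <= lim_value <= 1.
Proof.
rewrite mulr_ge0 ?invr_ge0 ?(ltW f_gt0) ?(ltW C_gt0) //= mulr_ile1 ?invr_ge0 ?(ltW f_gt0) ?(ltW C_gt0) //.
  by rewrite invf_le1 // ler1n fact_gt0.
by rewrite invf_le1 // ler1n bin_gt0 leq_addl.
Qed.

Lemma family_const_ge0 B c : 0 <= family_const R d B c.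
Proof. by apply: sumr_ge0 => m _; rewrite mulr_ge0 ?exprn_ge0. Qed.

(* The parameters are chosen in the order [lam], [del], [eta], [mu], [k], [n]. *)
Lemma ratio_ge (eps : R) : 0 < eps <= 1 ->
  exists N, forall n, (N <= n)%N -> lim_value - eps <= ratio n.
Proof.
move=> /andP[eps0 eps1]; set s : R := ('C(r, t))%:R.
pose A := family_const R d 4 t.
have A0 : 0 <= A := family_const_ge0 4 t.
(* Large enough that the conflict term [4 / lam * A] is at most [eps / 4]. *)
pose lam : R := 16%:R * A / eps + 1.
have lam0 : 0 < lam.
  by apply: ltr_wpDl => //; apply: divr_ge0 (ltW eps0); apply: mulr_ge0.
(* Collects the coefficients of [del ^+ 2] in [round_loss]: [s + lam] from the first term,
   [2 * lam], and 1 each for [eta], [mu] and the last term. With [del * c = eps / 4] the relative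
   loss is at most [eps / 4]. *)
pose c : R := s + 3%:R * lam + 3%:R.
have c3 : 3%:R <= c by rewrite /c; have := ltW C_gt0; rewrite -/s; lra.
have c0 : 0 < c by lra.
pose del : R := eps / (4%:R * c).
have delc : del * c = eps / 4%:R by rewrite /del; field; exact: lt0r_neq0.
have del0 : 0 < del by rewrite divr_gt0 // mulr_gt0.
have del1 : del <= 1 / 12%:R.
  have : del * 3%:R <= del * c by rewrite ler_wpM2l // ltW.
  by rewrite delc; lra.
(* Here [mu] is small against [eta ^+ 2 = del ^+ 4], so that the last term of [round_loss] is at
   most [del ^+ 2]. *)
pose eta := del ^+ 2; pose mu := del ^+ 6 / (8%:R * s + 1).
have s0 : 0 < s by exact: C_gt0.
have s81 : 0 < 8%:R * s + 1 by lra.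
have eta0 : 0 < eta by rewrite exprn_gt0.
have eta1 : eta <= 1 by rewrite exprn_ile1 ?ltW //; lra.
have mu0 : 0 < mu by rewrite divr_gt0 // exprn_gt0.
have del6 : del ^+ 6 <= del ^+ 2 by rewrite ler_wiXn2l ?(ltW del0) //; lra.
have mu_le : mu <= del ^+ 2.
  rewrite ler_pdivrMr //; apply: le_trans del6 _; rewrite ler_peMr ?(ltW eta0) //.
  by rewrite lerDr mulr_ge0 // ltW.
have loss_le : round_loss 'C(r, t) mu lam del eta <= del * (eps / 4%:R).
  have le1 : eta ^- 2 * (8%:R * mu * s) <= del ^+ 2.
    rewrite mulrC ler_pdivrMr ?exprn_gt0 // /eta -exprM -exprD.
    have -> : 8%:R * mu * s = del ^+ 6 * (8%:R * s / (8%:R * s + 1)).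
      by rewrite /mu; field; exact: lt0r_neq0.
    rewrite ler_piMr ?exprn_ge0 ?(ltW del0) // ler_pdivrMr // mul1r.
    by rewrite lerDl.
  have e1 : round_loss 'C(r, t) mu lam del eta = del ^+ 2 * (s + lam) + eta + mu +
      2%:R * del ^+ 2 * lam + eta ^- 2 * (8%:R * mu * s) by [].
  rewrite e1 -delc /c; move: mu_le le1; rewrite /eta.
  set x := _ ^- 2 * _; rewrite !expr2 => h1 h2; nra.
pose k := Num.bound (4%:R / (eps * del)).
have k_ge : 4%:R / (eps * del) <= k%:R.
  by apply/ltW/archi_boundP; rewrite divr_ge0 // mulr_ge0 // ltW.
pose q := (1 - del) ^+ k.
have q0 : 0 <= q by rewrite exprn_ge0 // subr_ge0; lra.
have q_le : q <= eps / 4%:R.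
  have dd : 0 <= del <= 1 by rewrite ltW //=; lra.
  have := geometric_le k dd; rewrite -/q => le1.
  have le2 : 4%:R / eps <= k%:R * del.
    have := ler_wpM2r (ltW del0) k_ge; apply: le_trans.
    by rewrite le_eqVlt; apply/orP; left; apply/eqP; field; rewrite !lt0r_neq0.
  have le3 := ler_wpM2l q0 le2.
  have le4 : q * (4%:R / eps) <= 1 by move: le1; rewrite mulrDr mulr1; lra.
  by move: le4; rewrite mulrA ler_pdivrMr // mul1r ler_pdivlMr.
pose B := bad_cost 'C(r, t) lam eta k * family_const R d 10 t.-1.
have B0 : 0 <= B.
  by rewrite mulr_ge0 ?family_const_ge0 // bad_cost_ge0 // ltW.
(* The threshold [N1] lets the initial weight double [k] times below [mu]; [N2] and [N3] serve the
   dense families and the gap between [t! * 'C(n, t)] and [n ^ t]. *)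
have [N1 hN1] := eventually_small (2%:R ^+ k * (growth d)%:R) mu0.
have eps8 : 0 < eps / 8%:R by rewrite divr_gt0.
have [N2 hN2] := eventually_small B eps8.
have [N3 hN3] := eventually_small (t%:R * t%:R) eps8.
exists (maxn (2 * (d + t)) (maxn N1 (maxn N2 N3))) => n.
rewrite !geq_max => /and4P[nr /hN1 le1 /hN2 le2 /hN3 le3].
have n0 : (0 < n)%N by apply: leq_trans nr; rewrite muln_gt0 addn_gt0 d0.
have nR : 0 < n%:R :> R by rewrite ltr0n.
have tn : (t + d <= n)%N by move: nr; clear; lia.
have Cd0 : 0 < ('C(n - t, d))%:R :> R.
  by rewrite ltr0n bin_gt0; move: tn; clear; lia.
have W_le : 2%:R ^+ k / ('C(n - t, d))%:R <= mu.
  apply: le_trans le1; rewrite -[leRHS]mulrA; apply: ler_wpM2l; first exact: exprn_ge0.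
  rewrite ler_pdivlMr //; apply: le_trans (scaled_weight_le R t2 d0 nr).
  rewrite mulrC; apply: ler_wpM2r; first by rewrite invr_ge0 ltW.
  by rewrite -{1}(expr1 n%:R) ler_weXn2l // ler1n.
have h_le : del * (s + lam) <= 1 / 2%:R.
  have : del * (s + lam) <= del * c by rewrite ler_wpM2l ?(ltW del0) // /c; lra.
  by rewrite delc; lra.
have del12 : del <= 1 / 2%:R by lra.
have eta01 : 0 < eta <= 1 by rewrite eta0.
have mu01 : 0 <= mu <= 1 by rewrite ltW //=; apply: le_trans mu_le _.
have loss_del : round_loss 'C(r, t) mu lam del eta <= del.
  by apply: le_trans loss_le _; rewrite ler_piMr ?(ltW del0) //; lra.
have := packing_exists t2 d0 nr lam0 del0 h_le del12 eta01 mu01 loss_del W_le.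
rewrite -/q -/A -/r mulrA -/B.
set a := round_loss _ _ _ _ _ / del; set b := (bes_number _ _ _ _)%:R => le_b.
have a_le : a <= eps / 4%:R by rewrite ler_pdivrMr // mulrC.
have nt0 : 0 < n%:R ^+ t :> R by rewrite exprn_gt0.
have S_ge : lim_value * (1 - t%:R * t%:R / n%:R) * n%:R ^+ t <=
    ('C(n, r))%:R / ('C(n - t, d))%:R.
  have -> : ('C(n, r))%:R / ('C(n - t, d))%:R = ('C(n, t))%:R / ('C(r, t))%:R :> R.
    apply/eqP; rewrite eqr_div ?lt0r_neq0 // -!natrM; apply/eqP; congr (_%:R).
    exact: bin_split.
  have tn' : (t <= n)%N by apply: leq_trans tn; apply: leq_addr.
  rewrite ler_pdivlMr // /lim_value.
  have := bin_natr_ge R n0 tn'; rewrite mulrA => le.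
  rewrite (_ : _ * _ * _ * _ = (n%:R ^+ t * (1 - t%:R * t%:R / n%:R)) / (t`!)%:R).
    by rewrite ler_pdivrMr // [leRHS]mulrC.
  by field; rewrite !lt0r_neq0.
rewrite /ratio mulrC ler_pdivlMr //; apply: le_trans le_b.
have z0 : 0 <= t%:R * t%:R / n%:R :> R by rewrite divr_ge0 ?mulr_ge0.
move: S_ge le3 z0; set z := t%:R * t%:R / n%:R; set S := _ / _ => S_ge z_le z0.
have A_le : 4%:R / lam * A <= eps / 4%:R.
  rewrite mulrAC ler_pdivrMr // /lam mulrDr mulr1.
  have -> : eps / 4%:R * (16%:R * A / eps) = 4%:R * A by field; exact: lt0r_neq0.
  by rewrite lerDl divr_ge0 // ltW.
have B_le : B * n%:R ^+ t.-1 <= eps / 8%:R * n%:R ^+ t.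
  rewrite -[in leRHS](prednK (ltnW t2)) exprS mulrA ler_wpM2r ?exprn_ge0 //.
  by rewrite -ler_pdivrMr.
have /andP[L0 L1] := lim_value_le1.
have aq : 0 <= (1 - a) * (1 - q) by rewrite mulr_ge0 // subr_ge0; lra.
have le_S := ler_wpM2l aq S_ge.
have a0 : 0 <= a.
  have d2 := exprn_ge0 2 (ltW del0); have le0 := ltW lam0; have m0 := ltW mu0.
  have sl : 0 <= s + lam by rewrite addr_ge0 // ltW.
  rewrite /a divr_ge0 ?(ltW del0) // /round_loss -/s; repeat apply: addr_ge0 => //.
  - exact: mulr_ge0.
  - by apply: mulr_ge0 => //; apply: mulr_ge0.
  - apply: mulr_ge0; first by rewrite invr_ge0 exprn_ge0 // ltW.
    by apply: mulr_ge0; [apply: mulr_ge0 | apply: ltW].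
have main : (lim_value - a - q - z) * n%:R ^+ t <= (1 - a) * (1 - q) * (lim_value * (1 - z) * n%:R ^+ t).
  rewrite [leRHS]mulrA; apply: ler_wpM2r; first exact: ltW.
  have : 1 - a - q <= (1 - a) * (1 - q) by have := mulr_ge0 a0 q0; lra.
  set y := (1 - a) * (1 - q) => y_ge; have y1 : y <= 1.
    have := mulr_ge0 a0 q0; have : (1 - a) * (1 - q) <= 1 * 1.
      by apply: ler_pM; rewrite ?subr_ge0 ?lerBlDr ?lerDl //; lra.
    by rewrite mul1r.
  have := mulr_ge0 L0 z0; have := ler_wpM2r L0 y_ge; have := ler_wpM2r (mulr_ge0 L0 z0) y1.
  have := ler_wpM2l a0 L1; have := ler_wpM2l q0 L1; have := ler_wpM2l z0 L1.
  rewrite -/y; nra.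
have A_n := ler_wpM2r (ltW nt0) A_le.
(* The budget: [a], [q] and the conflict term take [eps / 4] each, [z] and the dense families
   [eps / 8] each. *)
have eps_n : (lim_value - eps) * n%:R ^+ t <= (lim_value - a - q - z) * n%:R ^+ t -
    eps / 4%:R * n%:R ^+ t - eps / 8%:R * n%:R ^+ t.
  by rewrite -!mulrBl; apply: ler_wpM2r; [exact: ltW | lra].
apply: le_trans eps_n _; rewrite -/b; apply: lerB => //; apply: lerB.
  exact: le_trans main le_S.
by rewrite [leLHS]mulrA.
Qed.

End Asymptotics.

(* Convergence to the limit *)
From mathcomp Require Import all_classical all_reals all_analysis.
Import numFieldNormedType.Exports.
Local Open Scope classical_set_scope.

Theorem theorem1p4 (R : realType) (r t : nat)
  (hr : (4 <= r)%N) (ht2 : (2 <= t)%N) (htr : (t <= r - 1)%N) :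
  (fun n : nat => n%:R ^- t * (bes_number r n (4 * r - 3 * t) 4)%:R : R) @ \oo
    --> ((t`!)%:R^-1 * ('C(r, t))%:R^-1 : R).
Proof.
have [d d0 rE] : exists2 d, (0 < d)%N & r = (d + t)%N.
  by exists (r - t)%N; lia.
subst r; apply/cvgrPdist_le => /= eps eps0.
(* The lower bound [ratio_ge] is stated for [eps <= 1], hence the minimum with 1. *)
have eps1 : 0 < Num.min eps 1 <= 1 by rewrite lt_min eps0 ltr01 ge_min lexx orbT.
have [N1 hN1] := ratio_ge ht2 d0 eps1.
have [N2 hN2] := eventually_small 3%:R eps0.
exists (maxn 1 (maxn N1 N2)) => // n /=; rewrite !geq_max => /and3P[n0 /hN1 ge /hN2 le].
rewrite ler_distlC; apply/andP; split.
  by apply: le_trans ge; rewrite lerD2l lerN2 ge_min lexx.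
by apply: le_trans (ratio_le R ht2 d0 n0 hr) _; rewrite lerD2l.
Qed.
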